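(* Assume $g$ is separable, $g(x)=\sum_{j=1}^dg_j(x^{(j)})$, and that every row and every column of $A$ is nonzero. Run the sparse PURE-CD algorithm (described in the context) with, for all $k\ge0$, $$\tau_k^{(j)}=\tau^{(j)}=\frac{1}{\pi^{(j)}n\max_i\|A_i\|},\qquad \sigma_k^{(i)}=\sigma^{(i)}=\frac1{\|A_i\|},\qquad \theta_k^{(j)}=\theta^{(j)}=n\pi^{(j)},\qquad \pi^{(j)}=\frac{|I(j)|}{n}.$$ Let $K\ge1$ and let $\hat k$ be uniformly distributed on $\{1,\dots,K\}$, independent of all other randomness in the algorithm. Then for every nonempty compact set $\mathcal{Z}\subset\mathbb{R}^d\times\mathbb{R}^n$, $$\max_{(x,y)\in\mathcal{Z}}\mathbb{E}\,G(\bar x_{\hat k},\bar y_{\hat k},x,y)\le\frac{n\max_i\|A_i\|}{K}D_{\mathcal{Z}},$$ and hence, for every $\varepsilon>0$, $\max_{(x,y)\in\mathcal{Z}}\mathbb{E}\,G(\bar x_{\hat k},\bar y_{\hat k},x,y)\le\varepsilon$ is obtained with (expected) complexity $$O\left(\mathrm{nnz}(A)+\mathrm{nnz}(A)\max_i\|A_i\|\,D_{\mathcal{Z}}\,\varepsilon^{-1}\right).$$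
   Context: Problem: $\min_{x\in\mathbb{R}^d}\max_{y\in\mathbb{R}^n} L(x,y)$ with $L(x,y)=\langle Ax,y\rangle-h^*(y)+g(x)$, where $A\in\mathbb{R}^{n\times d}$ has rows $A_1,\dots,A_n$, $g:\mathbb{R}^d\to(-\infty,+\infty]$ and $h^*:\mathbb{R}^n\to(-\infty,+\infty]$ are proper convex lower semicontinuous, and $h^*(y)=\sum_{i=1}^n h_i^*(y^{(i)})$ is separable (superscript $(i)$ denotes the $i$-th coordinate). It is assumed that a saddle point $(x_\star,y_\star)$ exists: $L(x,y_\star)\ge L(x_\star,y_\star)\ge L(x_\star,y)$ for all $x,y$. Notation: $G(x',y',x,y)=L(x',y)-L(x,y')$. $\|\cdot\|$ is the Euclidean norm; $\mathrm{nnz}(A)$ is the number of nonzero entries of $A$; $J(i)=\{j:A_{i,j}\ne0\}$, $I(j)=\{i:A_{i,j}\neq0\}$. $\mathrm{prox}_{\mathrm{T},f}(x)=\arg\min_u\{f(u)+\frac12\langle u-x,\mathrm{T}^{-1}(u-x)\rangle\}$ for a positive diagonal matrix or positive scalar $\mathrm{T}$. $D_{\mathcal{Z}}=\max_{(x,y)\in\mathcal{Z}}(\|x-x_0\|^2+\|y-y_0\|^2)$. Sparse PURE-CD algorithm: start from deterministic $x_0\in\mathrm{dom}\,g$, $y_0\in\mathrm{dom}\,h^*$. Given positive step sizes $\tau_k^{(j)},\sigma_k^{(i)},\theta_k^{(j)}$, for $k=0,1,\dots$: 1. pick $i_k\in\{1,\dots,n\}$ uniformly at random, independently of the past; 2.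 $\bar x_{k+1}^{(j)}=\mathrm{prox}_{\tau_k^{(j)},g_j}\big(x_k^{(j)}-\tau_k^{(j)}(A^\top y_k)^{(j)}\big)$ for $j\in J(i_k)$; 3. $y_{k+1}^{(i_k)}=\mathrm{prox}_{\sigma_k^{(i_k)},h_{i_k}^*}\big(y_k^{(i_k)}+\sigma_k^{(i_k)}A_{i_k}\bar x_{k+1}\big)$, and $y_{k+1}^{(i)}=y_k^{(i)}$ for $i\ne i_k$; 4. $x_{k+1}^{(j)}=\bar x_{k+1}^{(j)}-\tau_k^{(j)}\theta_k^{(j)}A_{i_k,j}(y_{k+1}^{(i_k)}-y_k^{(i_k)})$ for $j\in J(i_k)$, and $x_{k+1}^{(j)}=x_k^{(j)}$ for $j\notin J(i_k)$. In statements, $\bar x_{k+1}$ denotes the full vector whose $j$-th coordinate is given by the formula in step 2 for every $j\in\{1,\dots,d\}$ (only the coordinates in $J(i_k)$ need be computed), and $\bar y_{k+1}=\mathrm{prox}_{\Sigma_k,h^*}(y_k+\Sigma_kA\bar x_{k+1})$ with $\Sigma_k=\mathrm{diag}(\sigma_k^{(1)},\dots,\sigma_k^{(n)})$. Complexity convention: the expected number of operations, where iteration $k$ costs $O(|J(i_k)|)$, i.e. $\frac1n\mathrm{nnz}(A)$ in expectation, and there is a one-time cost $O(\mathrm{nnz}(A))$ for computing $A^\top y_0$ (and for forming the output $\bar x_{\hat k},\bar y_{\hat k}$). *)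

(* Defs.v *)
From HB Require Import structures.
From mathcomp Require Import all_boot all_order all_algebra.
From mathcomp Require Import all_classical all_reals all_analysis.

Set Implicit Arguments.
Unset Strict Implicit.
Unset Printing Implicit Defensive.

Import Order.TTheory GRing.Theory Num.Theory.
Import numFieldNormedType.Exports.

Local Open Scope classical_set_scope.
Local Open Scope ring_scope.

(* The library norm on matrices is the sup norm, hence the explicit Euclidean
   one. *)
Definition dotp {R : realType} {m : nat} (u v : 'cV[R]_m) : R :=
  \sum_(i < m) u i 0 * v i 0.

Definition enorm {R : realType} {m : nat} (u : 'cV[R]_m) : R :=
  Num.sqrt (dotp u u).

Definition row_norm {R : realType} {n d : nat} (A : 'M[R]_(n, d)) (i : 'I_n) : R :=
  enorm (row i A)^T.

Definition max_row_norm {R : realType} {n d : nat} (A : 'M[R]_(n, d)) : R :=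
  \big[Num.max/0]_(i < n) row_norm A i.

Definition row_supp {R : realType} {n d : nat} (A : 'M[R]_(n, d)) (i : 'I_n)
  : {set 'I_d} := [set j | A i j != 0]%SET.

Definition col_supp {R : realType} {n d : nat} (A : 'M[R]_(n, d)) (j : 'I_d)
  : {set 'I_n} := [set i | A i j != 0]%SET.

Definition nnz {R : realType} {n d : nat} (A : 'M[R]_(n, d)) : nat :=
  #|[set ij : 'I_n * 'I_d | A ij.1 ij.2 != 0]%SET|.

Definition proper_fun {R : realType} {V : Type} (f : V -> \bar R) : Prop :=
  (forall x, f x != -oo%E) /\ (exists x, (f x < +oo)%E).

(* The right-hand side is well defined for f > -oo: in \bar R, 0 * +oo = 0. *)
Definition convex_efun {R : realType} {V : lmodType R} (f : V -> \bar R) : Prop :=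
  forall (x y : V) (t : R), 0 <= t <= 1 ->
    (f (t *: x + (1 - t) *: y)%R <= t%:E * f x + (1 - t)%:E * f y)%E.

Definition proper_convex_lsc {R : realType} {m : nat} (f : 'cV[R]_m -> \bar R)
  : Prop :=
  [/\ proper_fun f, convex_efun f & lower_semicontinuous f].

Definition separable_sum {R : realType} {m : nat}
    (f : 'cV[R]_m -> \bar R) (fs : 'I_m -> R -> \bar R) : Prop :=
  forall x, f x = (\sum_(i < m) fs i (x i 0%R))%E.

Definition lagrangian {R : realType} {n d : nat} (A : 'M[R]_(n, d))
    (g : 'cV[R]_d -> \bar R) (hconj : 'cV[R]_n -> \bar R)
    (x : 'cV[R]_d) (y : 'cV[R]_n) : \bar R :=
  ((dotp (A *m x) y)%:E - hconj y + g x)%E.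

Definition saddle_point {R : realType} {n d : nat} (A : 'M[R]_(n, d))
    (g : 'cV[R]_d -> \bar R) (hconj : 'cV[R]_n -> \bar R)
    (xs : 'cV[R]_d) (ys : 'cV[R]_n) : Prop :=
  forall x y,
    (lagrangian A g hconj xs ys <= lagrangian A g hconj x ys)%E /\
    (lagrangian A g hconj xs y <= lagrangian A g hconj xs ys)%E.

(* For x' in dom g and y' in dom h^* no indeterminate form arises: the value is
   -oo as soon as g x = +oo or h^* y = +oo. *)
Definition gap {R : realType} {n d : nat} (A : 'M[R]_(n, d))
    (g : 'cV[R]_d -> \bar R) (hconj : 'cV[R]_n -> \bar R)
    (x' : 'cV[R]_d) (y' : 'cV[R]_n) (x : 'cV[R]_d) (y : 'cV[R]_n) : \bar R :=
  (lagrangian A g hconj x' y - lagrangian A g hconj x y')%E.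

Definition argmin {R : realType} {V : Type} (F : V -> \bar R) : set V :=
  [set u | forall v, (F u <= F v)%E].

(* The chosen element of the argmin; the default value x is irrelevant when f is
   proper, convex and lower semicontinuous and the step is positive, since the
   argmin is then a singleton. *)
Definition prox {R : realType} (t : R) (f : R -> \bar R) (x : R) : R :=
  xget x (argmin (fun u => (f u + (2^-1 * (t^-1 * (u - x) ^+ 2))%:E)%E)).

Definition prox_diag {R : realType} {m : nat} (t : 'I_m -> R)
    (f : 'cV[R]_m -> \bar R) (x : 'cV[R]_m) : 'cV[R]_m :=
  xget x (argmin (fun u =>
    (f u + (2^-1 * dotp (u - x)
        (invmx (diag_mx (\row_i t i)) *m (u - x)))%:E)%E)).

Definition primal_step {R : realType} {n d : nat} (A : 'M[R]_(n, d))
    (gs : 'I_d -> R -> \bar R) (tau : 'I_d -> R)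
    (x : 'cV[R]_d) (y : 'cV[R]_n) : 'cV[R]_d :=
  \col_j prox (tau j) (gs j) (x j 0 - tau j * (A^T *m y) j 0).

Definition pure_cd_step {R : realType} {n d : nat} (A : 'M[R]_(n, d))
    (gs : 'I_d -> R -> \bar R) (hs : 'I_n -> R -> \bar R)
    (tau : 'I_d -> R) (sigma : 'I_n -> R) (theta : 'I_d -> R)
    (i : 'I_n) (xy : 'cV[R]_d * 'cV[R]_n) : 'cV[R]_d * 'cV[R]_n :=
  let: (x, y) := xy in
  let xbar := primal_step A gs tau x y in
  let yi := prox (sigma i) (hs i)
              (y i 0 + sigma i * (row i A *m xbar) 0 0) in
  (\col_j (if j \in row_supp A i
           then xbar j 0 - tau j * theta j * A i j * (yi - y i 0)
           else x j 0),
   \col_l (if l == i then yi else y l 0)).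

(* (x_k, y_k), for the sequence of sampled rows i *)
Fixpoint pure_cd {R : realType} {n d : nat} (A : 'M[R]_(n, d))
    (gs : 'I_d -> R -> \bar R) (hs : 'I_n -> R -> \bar R)
    (tau : nat -> 'I_d -> R) (sigma : nat -> 'I_n -> R)
    (theta : nat -> 'I_d -> R) (x0 : 'cV[R]_d) (y0 : 'cV[R]_n)
    (i : nat -> 'I_n) (k : nat) : 'cV[R]_d * 'cV[R]_n :=
  match k with
  | 0%N => (x0, y0)
  | k'.+1 => pure_cd_step A gs hs (tau k') (sigma k') (theta k') (i k')
               (pure_cd A gs hs tau sigma theta x0 y0 i k')
  end.

(* The pair (xbar_k, ybar_k); only meaningful for k >= 1, when it is computed
   from (x_{k-1}, y_{k-1}). *)
Definition pure_cd_bar {R : realType} {n d : nat} (A : 'M[R]_(n, d))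
    (gs : 'I_d -> R -> \bar R)
    (hconj : 'cV[R]_n -> \bar R) (hs : 'I_n -> R -> \bar R)
    (tau : nat -> 'I_d -> R) (sigma : nat -> 'I_n -> R)
    (theta : nat -> 'I_d -> R) (x0 : 'cV[R]_d) (y0 : 'cV[R]_n)
    (i : nat -> 'I_n) (k : nat) : 'cV[R]_d * 'cV[R]_n :=
  let: (x, y) := pure_cd A gs hs tau sigma theta x0 y0 i k.-1 in
  let xbar := primal_step A gs (tau k.-1) x y in
  (xbar,
   prox_diag (sigma k.-1) hconj
     (y + diag_mx (\row_l sigma k.-1 l) *m (A *m xbar))).

(* The sigma-algebra generated by a discrete random variable *)
Definition events_of {T S : Type} (X : T -> S) : set (set T) :=
  [set X @^-1` B | B in [set: set S]].

Definition mutually_independent {disp : measure_display}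
    {T : measurableType disp} {R : realType} (P : probability T R)
    {I : eqType} (F : I -> set (set T)) : Prop :=
  forall (s : seq I) (B : I -> set T), uniq s ->
    (forall i, i \in s -> F i (B i)) ->
    P (\bigcap_(i in [set` s]) B i) = (\prod_(i <- s) P (B i))%E.

(* i_0, i_1, ... uniform on the rows, khat uniform on {1, ..., K}, all of them
   mutually independent (the index None stands for khat). *)
Definition uniform_sampling {disp : measure_display}
    {T : measurableType disp} {R : realType} (P : probability T R)
    {n : nat} (i : nat -> T -> 'I_n) (K : nat) (khat : T -> nat) : Prop :=
  [/\ (forall k, events_of (i k) `<=` measurable) /\
        events_of khat `<=` measurable,
      forall k a, P (i k @^-1` [set a]) = (n%:R^-1)%:E,
      forall l, (1 <= l <= K)%N -> P (khat @^-1` [set l]) = (K%:R^-1)%:E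
    & mutually_independent P
        (fun o : option nat =>
           if o is Some k then events_of (i k) else events_of khat)].

Definition expected_gap {disp : measure_display}
    {T : measurableType disp} {R : realType} (P : probability T R)
    {n d : nat} (A : 'M[R]_(n, d))
    (g : 'cV[R]_d -> \bar R) (gs : 'I_d -> R -> \bar R)
    (hconj : 'cV[R]_n -> \bar R) (hs : 'I_n -> R -> \bar R)
    (tau : nat -> 'I_d -> R) (sigma : nat -> 'I_n -> R)
    (theta : nat -> 'I_d -> R) (x0 : 'cV[R]_d) (y0 : 'cV[R]_n)
    (i : nat -> T -> 'I_n) (khat : T -> nat)
    (z : 'cV[R]_d * 'cV[R]_n) : \bar R :=
  (\int[P]_w
     let: (xbar, ybar) :=
       pure_cd_bar A gs hconj hs tau sigma theta x0 y0 (i^~ w) (khat w) in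
     gap A g hconj xbar ybar z.1 z.2)%E.

Definition is_max_on {R : realType} {V : Type} (Z : set V) (f : V -> \bar R)
    (m : \bar R) : Prop :=
  (exists2 z, Z z & f z = m) /\ (forall z, Z z -> (f z <= m)%E).

(* Attained when Z is nonempty and compact *)
Definition DZ {R : realType} {n d : nat} (x0 : 'cV[R]_d) (y0 : 'cV[R]_n)
    (Z : set ('cV[R]_d * 'cV[R]_n)) : R :=
  sup [set enorm (z.1 - x0) ^+ 2 + enorm (z.2 - y0) ^+ 2 | z in Z].

(* A run of K iterations performs once + iter 0 + ... + iter (K - 1)
   operations, where once is O(nnz A) and iter k is O(|J(i_k)|) with a common
   constant c. *)
Definition operation_counts {disp : measure_display}
    {T : measurableType disp} {R : realType} {n d : nat} (A : 'M[R]_(n, d))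
    (i : nat -> T -> 'I_n) (c : R) (once : T -> R) (iter : nat -> T -> R)
  : Prop :=
  [/\ measurable_fun setT once,
      forall k, measurable_fun setT (iter k),
      forall w, 0 <= once w <= c * (nnz A)%:R
    & forall k w, 0 <= iter k w <= c * #|row_supp A (i k w)|%:R].

(* Main.v *)
(* One step of the algorithm, averaged over the sampled row a, decreases the
   Lyapunov function
     V(x', y') = M |x' - x|^2 + sum_i |A_i| (y'_i - y_i)^2,   M = max_i |A_i|,
   by at least (2/n) times the gap at (xbar, ybar): add the variational
   inequalities of all the proximal points; since theta_j tau_j = 1/M, the cross
   terms produced by the correction of x are the bilinear terms of the gap, and
   its quadratic terms |A_i|^2 (ybar_i - (y_k)_i)^2 / M are absorbed by the
   -|A_i| (ybar_i - (y_k)_i)^2 of the dual steps.  Telescoping over the K steps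
   and averaging over khat gives n V(x_0, y_0) / (2K), hence the bound.  The
   maximum over Z is attained because the expected gap is an affine function
   minus the lower semicontinuous g(x) + h^*(y). *)
Require Import Defs.
From HB Require Import structures.
From mathcomp Require Import all_boot all_order all_algebra.
From mathcomp Require Import all_classical all_reals all_analysis.
From mathcomp Require Import measurable_realfun ring lra.

Set Implicit Arguments.
Unset Strict Implicit.
Unset Printing Implicit Defensive.

Import Order.TTheory GRing.Theory Num.Theory.
Import numFieldNormedType.Exports.

Local Open Scope classical_set_scope.
Local Open Scope ring_scope.

(** * Lower semicontinuity and proximal points *)

Lemma continuous_lsc (R : realType) (V : topologicalType) (q : V -> R) :
  continuous q -> lower_semicontinuous (fun v => (q v)%:E).
Proof.
move=> cq; apply/lower_semicontinuousP => a.
rewrite (_ : mkset _ = q @^-1` [set u | a < u]); last first.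
  by apply/seteqP; split => v /=; rewrite lte_fin.
by apply: open_comp => [v _|]; [exact: cq|exact: open_gt].
Qed.

Lemma lsc_comp (R : realType) (U V : topologicalType) (q : U -> V)
    (f : V -> \bar R) :
  continuous q -> lower_semicontinuous f -> lower_semicontinuous (f \o q).
Proof.
move=> cq /lower_semicontinuousP lf; apply/lower_semicontinuousP => a.
by apply: (@open_comp _ _ q) (lf a) => u _; exact: cq.
Qed.

Lemma lsc_near (R : realType) (V : topologicalType) (f : V -> \bar R) v (a : R) :
  lower_semicontinuous f -> (a%:E < f v)%E -> \forall u \near v, (a%:E < f u)%E.
Proof. by move=> lf /lf[W nW Wf]; apply: filterS nW => u /Wf. Qed.

Lemma lsc_add (R : realType) (V : topologicalType) (f1 f2 : V -> \bar R) :
  (forall v, f1 v != -oo%E) -> (forall v, f2 v != -oo%E) ->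
  lower_semicontinuous f1 -> lower_semicontinuous f2 ->
  lower_semicontinuous (fun v => f1 v + f2 v)%E.
Proof.
move=> n1 n2 l1 l2 v a av.
(* The bound [a] splits into a bound below each summand: for finite values the slack [r1 + r2 - a]
   is halved, and an infinite value absorbs what the other one lacks. *)
have [b1 [b2 [b1f b2f ab]]] : exists b1 b2 : R,
    [/\ (b1%:E < f1 v)%E, (b2%:E < f2 v)%E & a <= b1 + b2].
  move: av (n1 v) (n2 v); case: (f1 v) => [r1||]//; case: (f2 v) => [r2||]// + _ _.
  - rewrite -EFinD lte_fin => ar.
    exists (r1 - (r1 + r2 - a) / 2), (r2 - (r1 + r2 - a) / 2).
    by rewrite !lte_fin; split; lra.
  - by move=> _; exists (r1 - 1), (a - r1 + 1); rewrite ltry lte_fin; split => //; lra.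
  - by move=> _; exists (a - r2 + 1), (r2 - 1); rewrite ltry lte_fin; split => //; lra.
  - by move=> _; exists a, 0; rewrite !ltry; split => //; lra.
exists [set u | (b1%:E < f1 u)%E /\ (b2%:E < f2 u)%E].
  by apply: filterI; exact: lsc_near.
move=> u [h1 h2]; apply: (@le_lt_trans _ _ (b1%:E + b2%:E)%E).
  by rewrite -EFinD lee_fin.
by apply: lteD.
Qed.

(* A cluster point of the filter of sublevel sets is a minimizer. *)
Lemma lsc_compact_min (R : realType) (V : topologicalType) (f : V -> \bar R)
    (K : set V) :
  (forall v, f v != -oo%E) -> lower_semicontinuous f -> compact K -> K !=set0 ->
  exists2 v, K v & forall u, K u -> (f v <= f u)%E.
Proof.
move=> nf lf cK [v0 Kv0].
pose S u := [set v | K v /\ (f v <= f u)%E].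
have FS : ProperFilter (filter_from K S).
  apply: filter_from_proper => [|u Ku]; last by exists u.
  apply: filter_from_filter => [|u v Ku Kv]; first by exists v0.
  have [uv|vu] := leP (f u) (f v).
    by exists u => // w [Kw wu]; do 2!split => //; exact: le_trans wu uv.
  by exists v => // w [Kw wv]; do 2!split => //; exact: le_trans wv (ltW vu).
have [|v [Kv cv]] := cK _ FS; first by exists v0 => // w [].
exists v => // u Ku; rewrite leNgt; apply/negP => uv.
have [r ru] : exists r : R, f u = r%:E.
  by case: (f u) (nf u) uv => [r||] // _; [exists r|rewrite ltNge leey].
(* A strict inequality [f u < f v] would persist near [v], but the cluster point [v] forces every
   neighbourhood to meet the sublevel set [S u]. *)
have nv : nbhs v [set w | (r%:E < f w)%E] by apply: lsc_near => //; rewrite -ru.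
have [w [[Kw wu] /=]] := cv _ _ (ex_intro2 _ _ u Ku (@subset_refl _ (S u))) nv.
by rewrite ltNge -ru wu.
Qed.

(* Unbundled on the scalar field, since [convex_efun] needs an lmodType. *)
Definition proper_convex_lsc1 (R : realType) (f : R -> \bar R) : Prop :=
  [/\ forall u, f u != -oo%E,
      exists u, (f u < +oo)%E,
      forall u v s : R, 0 <= s <= 1 ->
        (f (s * u + (1 - s) * v)%R <= s%:E * f u + (1 - s)%:E * f v)%E
    & lower_semicontinuous f].

Definition prox_obj (R : realType) (t : R) (f : R -> \bar R) (x u : R) : \bar R :=
  (f u + (2^-1 * (t^-1 * (u - x) ^+ 2))%:E)%E.

Section prox.
Variables (R : realType) (f : R -> \bar R).
Hypothesis pf : proper_convex_lsc1 f.

Let fN u : f u != -oo%E. Proof. by case: pf. Qed.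

Let fin u : (f u < +oo)%E -> f u \is a fin_num.
Proof. by move=> fu; rewrite fin_numE fN lt_eqF. Qed.

Lemma dom_fineK u : (f u < +oo)%E -> f u = (fine (f u))%:E.
Proof. by move=> /fin/fineK. Qed.

(* Comparing with the minimum over the interval of radius 1 about a point of the
   domain, convexity bounds f below by a cone outside that interval. *)
Lemma convex_lsc_linear_minorant : exists u0 B : R, (f u0 < +oo)%E /\
  forall u, 1 <= `|u - u0| -> ((fine (f u0) - B * `|u - u0|)%:E <= f u)%E.
Proof.
have [_ [u0 fu0] cf lf] := pf.
have I0 : `[u0 - 1, u0 + 1]%classic u0 by rewrite /= in_itv /=; lra.
have [v Iv vmin] :=
  lsc_compact_min fN lf (@segment_compact _ (u0 - 1) (u0 + 1)) (ex_intro _ _ I0).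
have fv : (f v < +oo)%E by apply: le_lt_trans fu0; exact: vmin.
exists u0, (fine (f u0) - fine (f v)); split => // u u1.
set r := `|u - u0| in u1 *.
have r0 : 0 < r by lra.
have s01 : 0 <= r^-1 <= 1 by rewrite invr_ge0 (ltW r0) /= invf_le1.
have := cf u u0 _ s01.
(* [w] is the point of the segment from [u0] to [u] at distance 1 from [u0], so [f v <= f w], and
   convexity turns this into a bound on [f u]. *)
set w := r^-1 * u + _.
have wE : w = u0 + r^-1 * (u - u0) by rewrite /w; ring.
have Iw : `[u0 - 1, u0 + 1]%classic w.
  rewrite /= in_itv /= wE.
  have : `|r^-1 * (u - u0)| <= 1.
    by rewrite normrM gtr0_norm ?invr_gt0// -/r mulVf ?gt_eqF.
  by rewrite ler_norml => /andP[]; lra.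
move: (vmin _ Iw) => /le_trans h /h{h}.
rewrite (dom_fineK fv) (dom_fineK fu0).
case: (f u) (fN u) => [fu| |] // _; last by rewrite leey.
rewrite -!EFinM -EFinD !lee_fin /= => h.
have : r * fine (f v) <= r * (r^-1 * fu + (1 - r^-1) * fine (f u0)) by rewrite ler_pM2l.
rewrite mulrDr !mulrA divff ?gt_eqF// mul1r mulrBr mulr1 divff ?gt_eqF//.
lra.
Qed.

(** The quadratic term outgrows the linear minorant of [f], so outside a large enough interval the
    objective exceeds its value at the centre [u0]; a minimizer on that compact interval is then
    global. *)
Lemma prox_obj_argmin_exists (t x : R) : 0 < t -> exists u, argmin (prox_obj t f x) u.
Proof.
move=> t0; have [u0 [B [fu0 lb]]] := convex_lsc_linear_minorant.
have [_ _ _ lf] := pf.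
pose q u := 2^-1 * (t^-1 * (u - x) ^+ 2).
have cq : continuous q.
  move=> u; apply: cvgMr; apply: cvgMr.
  apply: (@continuous_comp _ _ _ (fun u => u - x) (fun v => v ^+ 2)).
    by apply: cvgB => //; exact: cvg_cst.
  exact: exprn_continuous.
have ltot : lower_semicontinuous (prox_obj t f x).
  by apply: lsc_add => //; exact: continuous_lsc.
have nF u : prox_obj t f x u != -oo%E.
  by rewrite /prox_obj; case: (f u) (fN u).
(* The 1 makes the linear minorant applicable, [2 * t * |B|] lets the quadratic beat the slope [B],
   and [2 * |u0 - x|] pays for moving its centre from [x] to [u0]. *)
pose r := 1 + 2 * t * `|B| + 2 * `|u0 - x|.
have I0 : `[u0 - r, u0 + r]%classic u0.
  rewrite /= in_itv /=; have := normr_ge0 B; have := normr_ge0 (u0 - x).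
  have : 0 <= t * `|B| by rewrite mulr_ge0 ?(ltW t0).
  rewrite /r; lra.
have [v Iv vmin] :=
  lsc_compact_min nF ltot (@segment_compact _ (u0 - r) (u0 + r)) (ex_intro _ _ I0).
exists v => u.
have [|out] := boolP (u \in `[u0 - r, u0 + r]); first by move=> ?; apply: vmin.
apply: le_trans (vmin _ I0) _.
have rur : r < `|u - u0|.
  rewrite ltNge; apply: contra out => h; rewrite in_itv /=.
  by move: h; rewrite ler_norml => /andP[]; lra.
set s := `|u - u0| in rur.
have tB : 0 <= t * `|B| by rewrite mulr_ge0 ?(ltW t0).
have s1 : 1 <= s by have := normr_ge0 (u0 - x); rewrite /r in rur; lra.
rewrite /prox_obj; apply: le_trans (leeD2r _ (lb _ s1)).
rewrite (dom_fineK fu0) -!EFinD lee_fin /=.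
have -> : u - x = (u - u0) + (u0 - x) by ring.
set e := u0 - x in rur *.
suff : B * s <= 2^-1 * t^-1 * ((u - u0 + e) ^+ 2 - e ^+ 2) by rewrite -/s; lra.
have -> : (u - u0 + e) ^+ 2 - e ^+ 2 = s ^+ 2 + 2 * (u - u0) * e.
  by rewrite /s real_normK ?num_real//; ring.
have h1 : - (s * `|e|) <= (u - u0) * e.
  by rewrite lerNl -mulNr; apply: le_trans (ler_norm _) _; rewrite normrM normrN.
have h2 : s * (2 * t * `|B|) <= s ^+ 2 + 2 * (u - u0) * e.
  have : s * r <= s * s by rewrite ler_pM2l; lra.
  rewrite /r; nra.
have : 2^-1 * t^-1 * (s * (2 * t * `|B|)) <= 2^-1 * t^-1 * (s ^+ 2 + 2 * (u - u0) * e).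
  by rewrite ler_wpM2l// mulr_ge0// invr_ge0 ?(ltW t0)//.
apply: le_trans.
have -> : 2^-1 * t^-1 * (s * (2 * t * `|B|)) = s * `|B|.
  by field; rewrite gt_eqF.
by rewrite mulrC ler_wpM2l ?ler_norm//; lra.
Qed.

Lemma argmin_prox_obj_fin (t x u : R) : argmin (prox_obj t f x) u -> (f u < +oo)%E.
Proof.
move=> hu; have [_ [v fv] _ _] := pf.
have := hu v; rewrite /prox_obj (dom_fineK fv).
by case: (f u) (fN u) => [r||] //= _; rewrite ?ltry.
Qed.

(** First-order optimality without subgradients: [u] is compared with [s * v + (1 - s) * u],
    convexity is applied and the result divided by [s]; the error [a * s * (v - u) ^+ 2] vanishes
    with [s]. *)
Lemma prox_variational (t x u v : R) : 0 < t -> argmin (prox_obj t f x) u ->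
  (f v < +oo)%E -> fine (f u) - fine (f v) <= t^-1 * ((x - u) * (u - v)).
Proof.
move=> t0 hu fv; have fu := argmin_prox_obj_fin hu.
have [_ _ cf _] := pf.
set p := fine (f u); set q := fine (f v).
pose a := 2^-1 * t^-1.
have a0 : 0 < a by rewrite mulr_gt0 ?invr_gt0.
have key s : 0 < s <= 1 -> p - q <= t^-1 * ((x - u) * (u - v)) + a * s * (v - u) ^+ 2.
  move=> /andP[s0 s1].
  have s01 : 0 <= s <= 1 by lra.
  have := hu (s * v + (1 - s) * u); rewrite /prox_obj.
  move=> /le_trans /(_ (leeD2r _ (cf v u _ s01))).
  rewrite (dom_fineK fu) (dom_fineK fv) -!EFinM -!EFinD lee_fin -/p -/q => h.
  have h' : p + a * (u - x) ^+ 2 - a * (s * v + (1 - s) * u - x) ^+ 2 <=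
      s * q + (1 - s) * p by move: h; rewrite !(mulrA 2^-1) -/a; lra.
  have -> : t^-1 = 2 * a by rewrite /a; field; rewrite gt_eqF.
  rewrite -(ler_pM2l s0).
  have -> : s * (p - q) = p - (s * q + (1 - s) * p) by ring.
  rewrite lerBlDr -lerBlDl; apply: le_trans h'.
  rewrite le_eqVlt; apply/orP; left; apply/eqP; ring.
rewrite leNgt; apply/negP => lt.
set b := a * (v - u) ^+ 2.
have b0 : 0 <= b by rewrite mulr_ge0 ?sqr_ge0 ?(ltW a0).
set e := p - q - t^-1 * ((x - u) * (u - v)).
have e0 : 0 < e by rewrite /e subr_gt0.
(* An explicit [s] replaces the limit: [key] would give [e <= s * b], whereas this [s] makes
   [s * b < e]. *)
have s0 : 0 < e / (e + b + 1) by rewrite divr_gt0//; lra.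
have s1 : e / (e + b + 1) <= 1 by rewrite ler_pdivrMr; lra.
have := key (e / (e + b + 1)); rewrite s0 s1 => /(_ isT).
rewrite mulrAC -/b -lerBlDl -/e mulrA ler_pdivlMr; nra.
Qed.

(** The variational inequalities of [u] and [v], each tested at the other point, add up to
    [0 <= - t^-1 * (u - v) ^+ 2]. *)
Lemma argmin_prox_obj_unique (t x u v : R) : 0 < t ->
  argmin (prox_obj t f x) u -> argmin (prox_obj t f x) v -> u = v.
Proof.
move=> t0 hu hv; apply/eqP; rewrite -subr_eq0 -sqrf_eq0 eq_le sqr_ge0 andbT.
have := prox_variational t0 hu (argmin_prox_obj_fin hv).
have := prox_variational t0 hv (argmin_prox_obj_fin hu).
set a := t^-1; have a0 : 0 < a by rewrite invr_gt0.
move=> h1 h2; rewrite -(ler_pM2l a0) mulr0; nra.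
Qed.

(** Since a minimizer exists, [xget] does not fall back on its default value. *)
Lemma proxP (t x : R) : 0 < t -> argmin (prox_obj t f x) (prox t f x).
Proof.
move=> t0; have [u hu] := prox_obj_argmin_exists x t0.
by rewrite /prox -/(prox_obj t f x); apply: xgetI hu.
Qed.

End prox.

(** * Separable functions *)

Definition set_coord (R : realType) m (x : 'cV[R]_m) (j : 'I_m) (t : R) : 'cV[R]_m :=
  \col_l (if l == j then t else x l 0).

Lemma set_coord_continuous (R : realType) m (x : 'cV[R]_m) (j : 'I_m) :
  continuous (set_coord x j).
Proof.
move=> t A [P nP PA].
have : nbhs t (P j 0) by have := nP j 0; rewrite mxE eqxx.
apply: filterS => u Pu; apply: PA => k l; rewrite (ord1 l) mxE.
have [->//|kj] := eqVneq k j.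
by apply: nbhs_singleton; have := nP k 0; rewrite mxE (negPf kj).
Qed.

Section separable.
Variables (R : realType) (m : nat) (f : 'cV[R]_m -> \bar R) (fs : 'I_m -> R -> \bar R).
Hypotheses (pf : proper_convex_lsc f) (sf : separable_sum f fs).

(** In the sum of extended reals [-oo] absorbs [+oo], so one term [-oo] would make [f] equal to
    [-oo] at the constant vector [u]. *)
Lemma separable_neqNy j u : fs j u != -oo%E.
Proof.
have [[fN _] _ _] := pf.
apply/eqP => fju; have := fN (const_mx u).
rewrite sf esum_eqNy => /negP; apply; apply/existsP; exists j => /=.
by rewrite mxE fju.
Qed.

Lemma separable_lty x j : (f x < +oo)%E -> (fs j (x j 0%R) < +oo)%E.
Proof.
rewrite sf !ltey; apply: contra => /eqP fj; rewrite esum_eqy.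
  by apply/existsP; exists j; rewrite /= fj.
by move=> i _; exact: separable_neqNy.
Qed.

Lemma separable_lty_sum (x : 'cV[R]_m) : (forall j, (fs j (x j 0%R) < +oo)%E) -> (f x < +oo)%E.
Proof. by move=> fx; rewrite sf; exact: lte_sum_pinfty. Qed.

Lemma separable_fineE x : (f x < +oo)%E -> fine (f x) = \sum_j fine (fs j (x j 0)).
Proof.
move=> fx; rewrite sf sum_fine// => j _.
by rewrite fin_numE separable_neqNy lt_eqF// separable_lty.
Qed.

(** Through a point of the domain the other terms are finite, so each component is a coordinate
    slice of [f] shifted by a real number. This carries the properties of [f] to its components. *)
Lemma separable_set_coordE x j : (f x < +oo)%E ->
  exists b : R, forall t, f (set_coord x j t) = (fs j t + b%:E)%E.
Proof.
move=> fx; exists (fine (\sum_(l < m | l != j) fs l (x l 0%R)))%E => t.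
rewrite sf (bigD1 j)//= mxE eqxx fineK; last first.
  apply/sum_fin_numP => l _ lj.
  by rewrite fin_numE separable_neqNy lt_eqF// separable_lty.
by congr (_ + _)%E; apply: eq_bigr => l lj; rewrite mxE (negPf lj).
Qed.

Lemma separable_component j : proper_convex_lsc1 (fs j).
Proof.
have [[fN [x fx]] cf lf] := pf; have [b fb] := separable_set_coordE j fx.
split; first exact: separable_neqNy.
- by exists (x j 0); exact: separable_lty.
- move=> u v s s01; have := cf (set_coord x j u) (set_coord x j v) s s01.
  have -> : s *: set_coord x j u + (1 - s) *: set_coord x j v =
      set_coord x j (s * u + (1 - s) * v).
    by apply/colP => l; rewrite !mxE; case: ifP => // _; ring.
  rewrite !fb !muleDr ?fin_num_adde_defl//.
  rewrite addeACA -!EFinM -[in X in (_ <= X)%E -> _]EFinD.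
  (* The weights [s] and [1 - s] add up to 1, so the shift [b] cancels. *)
  by rewrite (_ : s * b + _ = b) ?leeD2rE//; ring.
- rewrite (_ : fs j = fun t => (f (set_coord x j t) + (- b)%:E)%E); last first.
    by apply/funext => t; rewrite fb -addeA -EFinD subrr adde0.
  apply: lsc_add => // [v|].
    exact: (lsc_comp (@set_coord_continuous _ _ x j) lf).
  by apply: (@continuous_lsc _ _ (fun=> - b)); exact: cst_continuous.
Qed.

Lemma invmx_diag (t : 'I_m -> R) : (forall i, t i != 0) ->
  invmx (diag_mx (\row_i t i)) = diag_mx (\row_i (t i)^-1).
Proof.
move=> t0; have tt : diag_mx (\row_i t i) *m diag_mx (\row_i (t i)^-1) = 1%:M.
  rewrite mulmx_diag -diag_const_mx; congr diag_mx; apply/rowP => i.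
  by rewrite !mxE divff.
have [tu _] := mulmx1_unit tt.
by rewrite -[LHS]mulmx1 -tt mulKmx.
Qed.

(** The objective is a sum of scalar objectives, all minimized by [p]. A minimizer of the sum must
    then minimize each term, and scalar minimizers are unique. *)
Lemma prox_diag_separable (t : 'I_m -> R) x : (forall i, 0 < t i) ->
  prox_diag t f x = \col_i prox (t i) (fs i) (x i 0).
Proof.
move=> t0.
have objE u : (f u + (2^-1 * dotp (u - x)
    (invmx (diag_mx (\row_i t i)) *m (u - x)))%:E =
    \sum_(i < m) prox_obj (t i) (fs i) (x i 0%R) (u i 0%R))%E.
  rewrite sf /dotp mulr_sumr -sumEFin -big_split/=; apply: eq_bigr => i _.
  rewrite invmx_diag; last by move=> l; rewrite gt_eqF.
  congr (_ + _%:E)%E; rewrite mul_diag_mx !mxE; ring.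
set p := (\col_i _ : 'cV[R]_m).
have pmin i : argmin (prox_obj (t i) (fs i) (x i 0)) (p i 0).
  by rewrite mxE; apply: proxP => //; exact: separable_component.
rewrite /prox_diag; set F := (fun u => _)%E.
have FE : F = fun u => (\sum_(i < m) prox_obj (t i) (fs i) (x i 0%R) (u i 0%R))%E.
  exact/funext.
have Fp : argmin F p.
  by move=> u; rewrite FE; apply: lee_sum => i _; exact: pmin.
move: (xgetI x Fp); set u := xget _ _ => Fu.
apply/colP => i.
apply: (argmin_prox_obj_unique (separable_component i) (t0 i) (x := x i 0)) => // v.
apply: le_trans (pmin i v).
have pfin l : prox_obj (t l) (fs l) (x l 0) (p l 0) \is a fin_num.
  rewrite fin_numD andbT fin_numE separable_neqNy lt_eqF//.
  exact: (argmin_prox_obj_fin (separable_component l) (pmin l)).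
(* The terms other than [i] are no larger at [p] than at [u]; as their sum [Sp] is finite, it can be
   cancelled, leaving the comparison of the terms [i]. *)
have := Fu p; rewrite FE (bigD1 i)//= [X in (_ <= X)%E](bigD1 i)//=.
set Su := (\sum_(l < m | l != i) _)%E; set Sp := (\sum_(l < m | l != i) _)%E.
have SpSu : (Sp <= Su)%E by apply: lee_sum => l _; exact: pmin.
have Spfin : Sp \is a fin_num by apply/sum_fin_numP => l _ _; exact: pfin.
by move=> /(le_trans (leeD2l _ SpSu)); rewrite leeD2rE.
Qed.

End separable.

(** * One step of the algorithm *)

Section one_step_real.
Variables (R : realType) (n d : nat) (A : 'M[R]_(n, d)).
Let r := row_norm A.
Let M := max_row_norm A.

Lemma row_norm_sqr i : r i ^+ 2 = \sum_j A i j ^+ 2.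
Proof.
rewrite sqr_sqrtr; last by apply: sumr_ge0 => j _; rewrite -expr2 sqr_ge0.
by apply: eq_bigr => j _; rewrite !mxE expr2.
Qed.

Lemma row_norm_le_max i : r i <= M.
Proof. exact: le_bigmax. Qed.

Lemma row_norm_gt0 i : row i A != 0 -> 0 < r i.
Proof.
move=> Ai; rewrite lt_def sqrtr_ge0 andbT -sqrf_eq0 row_norm_sqr.
apply: contra Ai => /eqP A0; apply/eqP/rowP => j; rewrite !mxE.
apply/eqP; rewrite -sqrf_eq0; apply/eqP.
by apply: (psumr_eq0P _ A0) => // l _; rewrite sqr_ge0.
Qed.

Definition lyapunov (x : 'cV[R]_d) (y : 'cV[R]_n) (p : 'cV[R]_d * 'cV[R]_n) : R :=
  M * (\sum_j (p.1 j 0 - x j 0) ^+ 2) + \sum_i r i * (p.2 i 0 - y i 0) ^+ 2.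

Lemma lyapunov_ge0 x y p : 0 <= lyapunov x y p.
Proof.
rewrite addr_ge0//.
  by rewrite mulr_ge0 ?bigmax_ge_id// sumr_ge0// => j _; exact: sqr_ge0.
by apply: sumr_ge0 => i _; rewrite mulr_ge0 ?sqrtr_ge0 ?sqr_ge0.
Qed.

(** Coordinate [l] moves only when row [l] is drawn, so after exchanging the sums one inner term
    survives. *)
Lemma sum_update_dual (yk yb y : 'I_n -> R) :
  \sum_a \sum_l (r l * (yk l - y l) ^+ 2 -
                 r l * ((if l == a then yb l else yk l) - y l) ^+ 2) =
  \sum_l (r l * (yk l - y l) ^+ 2 - r l * (yb l - y l) ^+ 2).
Proof.
rewrite exchange_big; apply: eq_bigr => l _.
rewrite (bigD1 l)//= eqxx big1 ?addr0// => a al.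
by rewrite eq_sym (negPf al) subrr.
Qed.

(** Coordinate [j] moves for exactly the rows of its column support, hence the weight
    [#|col_supp A j|]. Expanding the square of the corrected coordinate yields the cross term and
    the quadratic term, where the squared entries of row [a] add up to [r a ^+ 2]. *)
Lemma sum_update_primal (xk xb x : 'I_d -> R) (e : 'I_n -> R) : 0 < M ->
  \sum_a \sum_j (M * (xk j - x j) ^+ 2 -
     M * ((if A a j != 0 then xb j - M^-1 * A a j * e a else xk j) - x j) ^+ 2) =
  \sum_j #|col_supp A j|%:R * (M * ((xk j - x j) ^+ 2 - (xb j - x j) ^+ 2)) +
  (\sum_a \sum_j 2 * (A a j * (e a * (xb j - x j)))
   - \sum_a M^-1 * (r a ^+ 2 * e a ^+ 2)).
Proof.
move=> M0.
have -> : \sum_j #|col_supp A j|%:R * (M * ((xk j - x j) ^+ 2 - (xb j - x j) ^+ 2)) =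
  \sum_a \sum_j (if A a j != 0 then M * ((xk j - x j) ^+ 2 - (xb j - x j) ^+ 2) else 0).
  rewrite exchange_big; apply: eq_bigr => j _.
  rewrite -big_mkcond/= sumr_const mulr_natl; congr (_ *+ _).
  by apply: eq_card => a; rewrite inE.
have -> : \sum_a M^-1 * (r a ^+ 2 * e a ^+ 2) =
    \sum_a \sum_j M^-1 * (A a j ^+ 2 * e a ^+ 2).
  by apply: eq_bigr => a _; rewrite row_norm_sqr mulr_suml mulr_sumr.
rewrite -sumrB -big_split/=; apply: eq_bigr => a _.
rewrite -sumrB -big_split/=; apply: eq_bigr => j _.
case: eqP => [->|_] /=; first by rewrite subrr; ring.
by field; rewrite gt_eqF.
Qed.

(* [dg] and [dh] are the coordinatewise differences of g and h^*; the two
   hypotheses bounding them are the variational inequalities of the prox. *)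
Lemma one_step_real (xk xb x : 'I_d -> R) (yk yb y : 'I_n -> R)
    (dg : 'I_d -> R) (dh : 'I_n -> R) :
  0 < M -> (forall i, 0 < r i) ->
  (forall j, (0 < #|col_supp A j|)%N) ->
  (forall j, let t := (#|col_supp A j|%:R * M)^-1 in
     dg j <= t^-1 * ((xk j - t * (\sum_i A i j * yk i) - xb j) * (xb j - x j))) ->
  (forall i, let t := (r i)^-1 in
     dh i <= t^-1 * ((yk i + t * (\sum_j A i j * xb j) - yb i) * (yb i - y i))) ->
  2 * (\sum_j dg j + \sum_i dh i + \sum_i (\sum_j A i j * xb j) * y i
       - \sum_i (\sum_j A i j * x j) * yb i) <=
  \sum_a (\sum_j (M * (xk j - x j) ^+ 2 -
     M * ((if A a j != 0 then xb j - M^-1 * A a j * (yb a - yk a) else xk j) - x j) ^+ 2)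
   + \sum_l (r l * (yk l - y l) ^+ 2 -
                 r l * ((if l == a then yb l else yk l) - y l) ^+ 2)).
Proof.
move=> M0 r0 c0 hg hh.
rewrite big_split/= sum_update_dual (sum_update_primal xk xb x (fun a => yb a - yk a) M0).
set Gs := \sum_j dg j; set Hs := \sum_i dh i.
set SI := \sum_j _ * (M * _); set SM := \sum_a M^-1 * _.
set SC := \sum_a \sum_j _; set SD := \sum_l (_ - _).
(* [B u v] is the bilinear form of [A]; once every coupling term is written with it, only linear
   arithmetic remains. *)
pose B (u : 'I_n -> R) (v : 'I_d -> R) := \sum_i \sum_j A i j * (u i * v j).
have BE u v : \sum_i (\sum_j A i j * v j) * u i = B u v.
  by apply: eq_bigr => i _; rewrite mulr_suml; apply: eq_bigr => j _; ring.
(* Twice [(xk - xb) * (xb - x)] is a difference of squared distances to [x] minus [(xk - xb) ^+ 2];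
   this last square is dropped. *)
have hG : 2 * Gs <= SI - 2 * B yk (fun j => xb j - x j).
  have -> : B yk (fun j => xb j - x j) = \sum_j (\sum_i A i j * yk i) * (xb j - x j).
    rewrite /B exchange_big; apply: eq_bigr => j _; rewrite mulr_suml.
    by apply: eq_bigr => i _; rewrite mulrA.
  rewrite !mulr_sumr -sumrB; apply: ler_sum => j _.
  have := hg j; cbv zeta; set c := #|_|%:R.
  have c1 : 0 < c by rewrite ltr0n.
  set s := \sum_i _; rewrite invrK => h.
  have cM : 0 < c * M by rewrite mulr_gt0.
  have E : c * M * ((xk j - (c * M)^-1 * s - xb j) * (xb j - x j)) =
    c * M * ((xk j - xb j) * (xb j - x j)) - s * (xb j - x j).
    by field; rewrite !gt_eqF.
  rewrite E in h.
  have : 0 <= c * M * (xk j - xb j) ^+ 2 by rewrite mulr_ge0 ?sqr_ge0// ltW.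
  by move: h; rewrite mulrA; nra.
(* The same identity for the dual, but the square [(yb - yk) ^+ 2] is kept: as [r i <= M], it
   dominates the quadratic term [SM] left by the primal correction. *)
have hH : 2 * Hs <= SD - SM + 2 * B (fun i => yb i - y i) xb.
  rewrite -BE !mulr_sumr -sumrB -big_split/=; apply: ler_sum => i _.
  have := hh i; cbv zeta; set s := \sum_j _; rewrite invrK => h.
  have E : r i * ((yk i + (r i)^-1 * s - yb i) * (yb i - y i)) =
    r i * ((yk i - yb i) * (yb i - y i)) + s * (yb i - y i).
    by field; rewrite !gt_eqF.
  rewrite E in h.
  have : M^-1 * (r i ^+ 2 * (yb i - yk i) ^+ 2) <= r i * (yb i - yk i) ^+ 2.
    rewrite mulrA ler_wpM2r ?sqr_ge0// ler_pdivrMl// expr2 ler_wpM2r//.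
      exact: ltW.
    exact: row_norm_le_max.
  by move: h; nra.
rewrite !BE.
have -> : SC = 2 * B (fun a => yb a - yk a) (fun j => xb j - x j).
  rewrite mulr_sumr; apply: eq_bigr => a _; rewrite mulr_sumr.
  by apply: eq_bigr => j _.
have Bx u v1 v2 : B u (fun j => v1 j - v2 j) = B u v1 - B u v2.
  rewrite -sumrB; apply: eq_bigr => i _; rewrite -sumrB.
  by apply: eq_bigr => j _; ring.
have By u1 u2 v : B (fun j => u1 j - u2 j) v = B u1 v - B u2 v.
  rewrite -sumrB; apply: eq_bigr => i _; rewrite -sumrB.
  by apply: eq_bigr => j _; ring.
move: hG hH; rewrite !Bx !By; lra.
Qed.

End one_step_real.

Section one_step.
Variables (R : realType) (n d : nat) (A : 'M[R]_(n, d)).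
Variables (g : 'cV[R]_d -> \bar R) (gs : 'I_d -> R -> \bar R).
Variables (h : 'cV[R]_n -> \bar R) (hs : 'I_n -> R -> \bar R).
Hypotheses (pg : proper_convex_lsc g) (ph : proper_convex_lsc h).
Hypotheses (sg : separable_sum g gs) (sh : separable_sum h hs).
Hypotheses (M0 : 0 < max_row_norm A) (r0 : forall i, 0 < row_norm A i).
Hypothesis c0 : forall j, (0 < #|col_supp A j|)%N.
Variables (tau : 'I_d -> R) (sigma : 'I_n -> R) (theta : 'I_d -> R).
Hypothesis tauE : forall j, tau j = (#|col_supp A j|%:R * max_row_norm A)^-1.
Hypothesis sigmaE : forall i, sigma i = (row_norm A i)^-1.
Hypothesis thetaE : forall j, theta j = #|col_supp A j|%:R.

(** It depends on the current iterate only, not on the row about to be drawn, so its gap can be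
    compared with the average over that row. *)
Definition bar_pair (p : 'cV[R]_d * 'cV[R]_n) : 'cV[R]_d * 'cV[R]_n :=
  let xbar := primal_step A gs tau p.1 p.2 in
  (xbar, prox_diag sigma h (p.2 + diag_mx (\row_l sigma l) *m (A *m xbar))).

Definition gap_real (b : 'cV[R]_d * 'cV[R]_n) (x : 'cV[R]_d) (y : 'cV[R]_n) : R :=
  fine (g b.1) + fine (h b.2) + dotp (A *m b.1) y - dotp (A *m x) b.2
  - (fine (g x) + fine (h y)).

Lemma tau_gt0 j : 0 < tau j.
Proof. by rewrite tauE invr_gt0 mulr_gt0// ltr0n. Qed.

Lemma sigma_gt0 i : 0 < sigma i.
Proof. by rewrite sigmaE invr_gt0. Qed.

(** Coordinate [i] of the full dual proximal point is the value that the algorithm computes when row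
    [i] is drawn. *)
Lemma bar_pair2E p i : (bar_pair p).2 i 0 =
  prox (sigma i) (hs i) (p.2 i 0 + sigma i * (A *m (bar_pair p).1) i 0).
Proof.
rewrite /bar_pair /= (prox_diag_separable ph sh _ sigma_gt0) mxE.
by congr prox; rewrite mxE mul_diag_mx !mxE.
Qed.

Lemma bar_pair1E p j : (bar_pair p).1 j 0 =
  prox (tau j) (gs j) (p.1 j 0 - tau j * (\sum_i A i j * p.2 i 0)).
Proof.
rewrite mxE; congr prox; congr (_ - _ * _); rewrite mxE.
by apply: eq_bigr => i _; rewrite mxE.
Qed.

Lemma bar_pair_lty1 p : (g (bar_pair p).1 < +oo)%E.
Proof.
apply: (separable_lty_sum sg) => j; rewrite bar_pair1E.
have cj := separable_component pg sg j.
exact: (argmin_prox_obj_fin cj (proxP cj _ (tau_gt0 j))).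
Qed.

Lemma bar_pair_lty2 p : (h (bar_pair p).2 < +oo)%E.
Proof.
apply: (separable_lty_sum sh) => i; rewrite bar_pair2E.
have ci := separable_component ph sh i.
exact: (argmin_prox_obj_fin ci (proxP ci _ (sigma_gt0 i))).
Qed.

Lemma gap_fin p x y : (g x < +oo)%E -> (h y < +oo)%E ->
  gap A g h (bar_pair p).1 (bar_pair p).2 x y = (gap_real (bar_pair p) x y)%:E.
Proof.
move=> gx hy.
have gb := bar_pair_lty1 p; have hb := bar_pair_lty2 p.
have [[gN _] _ _] := pg; have [[hN _] _ _] := ph.
rewrite /gap /lagrangian.
have fg z : (g z < +oo)%E -> g z = (fine (g z))%:E.
  by move=> gz; rewrite fineK// fin_numE gN lt_eqF.
have fh z : (h z < +oo)%E -> h z = (fine (h z))%:E.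
  by move=> hz; rewrite fineK// fin_numE hN lt_eqF.
rewrite (fg _ gx) (fg _ gb) (fh _ hy) (fh _ hb).
rewrite -!EFinN -!EFinD; congr (_%:E); rewrite /gap_real /=; ring.
Qed.

(** Both bar points lie in the domains, so the first Lagrangian is finite or [-oo], the second
    finite or [+oo], and no indeterminate form arises in their difference. *)
Lemma gap_Ny p x y : (g x + h y = +oo)%E ->
  gap A g h (bar_pair p).1 (bar_pair p).2 x y = -oo%E.
Proof.
move=> gh; rewrite /gap /lagrangian.
have := bar_pair_lty1 p; have := bar_pair_lty2 p.
have [[gN _] _ _] := pg; have [[hN _] _ _] := ph.
move: (gN x) (gN (bar_pair p).1) (hN y) (hN (bar_pair p).2) gh.
by case: (g x) => [?||]//; case: (g _) => [?||]//; case: (h y) => [?||]//;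
  case: (h _) => [?||].
Qed.

Lemma mulmx_colE (B : 'M[R]_(n, d)) (v : 'cV[R]_d) i : (B *m v) i 0 = \sum_j B i j * v j 0.
Proof. by rewrite mxE. Qed.

Lemma row_mulmxE (B : 'M[R]_(n, d)) (v : 'cV[R]_d) i :
  (row i B *m v) 0 0 = (B *m v) i 0.
Proof. by rewrite -row_mul mxE. Qed.

Lemma one_step p x y : (g x < +oo)%E -> (h y < +oo)%E ->
  2 * gap_real (bar_pair p) x y <=
  \sum_a (lyapunov A x y p - lyapunov A x y (pure_cd_step A gs hs tau sigma theta a p)).
Proof.
move=> gx hy; set b := bar_pair p.
have hG j : let t := (#|col_supp A j|%:R * max_row_norm A)^-1 in
   fine (gs j (b.1 j 0)) - fine (gs j (x j 0)) <=
   t^-1 * ((p.1 j 0 - t * (\sum_i A i j * p.2 i 0) - b.1 j 0) * (b.1 j 0 - x j 0)).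
  cbv zeta; rewrite -tauE.
  have cj := separable_component pg sg j.
  rewrite /b bar_pair1E.
  exact: (prox_variational cj (tau_gt0 j) (proxP cj _ (tau_gt0 j))
    (separable_lty pg sg j gx)).
have hH i : let t := (row_norm A i)^-1 in
   fine (hs i (b.2 i 0)) - fine (hs i (y i 0)) <=
   t^-1 * ((p.2 i 0 + t * (\sum_j A i j * b.1 j 0) - b.2 i 0) * (b.2 i 0 - y i 0)).
  cbv zeta; rewrite -sigmaE -mulmx_colE /b bar_pair2E.
  have ci := separable_component ph sh i.
  exact: (prox_variational ci (sigma_gt0 i) (proxP ci _ (sigma_gt0 i))
    (separable_lty ph sh i hy)).
have := one_step_real M0 r0 c0 hG hH.
congr (_ <= _).
  rewrite !sumrB -(separable_fineE pg sg gx) -(separable_fineE pg sg (bar_pair_lty1 p)).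
  rewrite -(separable_fineE ph sh hy) -(separable_fineE ph sh (bar_pair_lty2 p)).
  rewrite /gap_real /dotp -/b; congr (_ * _).
  under [\sum_i (A *m b.1) i 0 * _]eq_bigr do rewrite mulmx_colE.
  under [\sum_i (A *m x) i 0 * _]eq_bigr do rewrite mulmx_colE.
  ring.
apply: eq_bigr => a _; rewrite /lyapunov opprD addrACA; congr (_ + _).
  rewrite !mulr_sumr -sumrB; apply: eq_bigr => j _; congr (_ - _ * (_ - _) ^+ 2).
  (* The column count cancels: the correction has the same factor [1 / M] in every coordinate,
     matching the primal weight of the Lyapunov function. *)
  have E : tau j * theta j = (max_row_norm A)^-1.
    by rewrite tauE thetaE; field; rewrite gt_eqF// pnatr_eq0 -lt0n c0.
  have ybE : (bar_pair p).2 a 0 =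
      prox (sigma a) (hs a) (p.2 a 0 + sigma a * (row a A *m (bar_pair p).1) 0 0).
    by rewrite bar_pair2E row_mulmxE.
  case: p @b E ybE {hG hH} => xk yk b E ybE.
  by rewrite /pure_cd_step /= mxE inE; case: ifP => // _; rewrite E -/(bar_pair (xk, yk)) -ybE.
rewrite -sumrB; apply: eq_bigr => l _; congr (_ - _ * (_ - _) ^+ 2).
case: p @b {hG hH} => xk yk b.
rewrite /pure_cd_step /= mxE; case: eqP => // ->.
rewrite row_mulmxE; exact: (bar_pair2E (xk, yk) a).
Qed.

End one_step.

(** * Averaging over the sampled rows *)

Section averaging.
Variables (R : realType) (n K : nat) (a0 : 'I_n).

(** A finite word of rows becomes the infinite sequence that the recursion reads; [a0] is mere
    padding beyond the first [K] draws. *)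
Definition extend (phi : {ffun 'I_K -> 'I_n}) (k : nat) : 'I_n :=
  if insub k is Some o then phi o else a0.

Lemma extend_ord phi (k : 'I_K) : extend phi k = phi k.
Proof. by rewrite /extend valK. Qed.

Definition ffun_upd (phi : {ffun 'I_K -> 'I_n}) (k : 'I_K) (a : 'I_n) :=
  [ffun l => if l == k then a else phi l].

(* The swap (phi, a) |-> (phi[k := a], phi k) is an involution. *)
Lemma sum_ffun_upd (k : 'I_K) (H : {ffun 'I_K -> 'I_n} -> R) :
  \sum_phi \sum_a H (ffun_upd phi k a) = n%:R * \sum_phi H phi.
Proof.
pose swap (p : {ffun 'I_K -> 'I_n} * 'I_n) := (ffun_upd p.1 k p.2, p.1 k).
have swapK : involutive swap.
  move=> [phi a]; rewrite /swap /= ffunE eqxx; congr pair.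
  by apply/ffunP => l; rewrite !ffunE; case: eqP => // ->.
rewrite pair_big/= (reindex_inj (inv_inj swapK))/=.
under eq_bigr => p _ do rewrite -[ffun_upd _ _ _]/(swap (swap p)).1 swapK.
rewrite -(pair_big xpredT xpredT (fun phi (_ : 'I_n) => H phi))/= mulr_sumr.
by apply: eq_bigr => phi _; rewrite sumr_const card_ord mulr_natl.
Qed.

Variables (S : Type) (step : 'I_n -> S -> S) (s0 : S).
Variable run : (nat -> 'I_n) -> nat -> S.
Hypothesis run0 : forall i, run i 0%N = s0.
Hypothesis runS : forall i k, run i k.+1 = step (i k) (run i k).

Lemma eq_run i i' k : (forall l, (l < k)%N -> i l = i' l) -> run i k = run i' k.
Proof.
elim: k => [|k IH] ii'; first by rewrite !run0.
by rewrite !runS ii'// IH// => l lk; rewrite ii'// ltnW.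
Qed.

(** The state at time [k] depends only on the draws before [k], so resampling draw [k] affects just
    the last step. *)
Lemma run_ffun_upd phi (k : 'I_K) a :
  run (extend (ffun_upd phi k a)) k.+1 = step a (run (extend phi) k).
Proof.
rewrite runS extend_ord ffunE eqxx; congr step; apply: eq_run => l lk.
have lK : (l < K)%N by apply: ltn_trans lk _.
rewrite -[l]/(nat_of_ord (Ordinal lK)) !extend_ord ffunE -val_eqE /=.
by rewrite ltn_eqF.
Qed.

(** Expectations appear as sums over all [n ^ K] words. Resampling draw [k] turns the one-step
    inequality into a decrease of the total [W], which telescopes; the final total is nonnegative
    and is dropped. *)
Lemma descent_sum (F V : S -> R) :
  (forall s, 0 <= V s) ->
  (forall s, 2 * F s <= \sum_a (V s - V (step a s))) ->
  2 * (\sum_(k < K) \sum_phi F (run (extend phi) k)) <= (n ^ K.+1)%:R * V s0.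
Proof.
move=> V0 FV; pose W k := \sum_phi V (run (extend phi) k).
have stepW (k : 'I_K) : 2 * (\sum_phi F (run (extend phi) k)) <= n%:R * (W k - W k.+1).
  rewrite mulrBr -(sum_ffun_upd k (fun phi => V (run (extend phi) k.+1))).
  rewrite /W !mulr_sumr -sumrB; apply: ler_sum => phi _.
  apply: le_trans (FV _) _; rewrite sumrB sumr_const card_ord mulr_natl lerD2l lerN2.
  by rewrite le_eqVlt; apply/orP; left; apply/eqP; apply: eq_bigr => a _; rewrite run_ffun_upd.
rewrite mulr_sumr; apply: le_trans (ler_sum _ (fun k _ => stepW k)) _.
rewrite -mulr_sumr expnS natrM -mulrA ler_wpM2l//.
rewrite -(big_mkord xpredT (fun k => W k - W k.+1)).
under eq_bigr do rewrite -opprB.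
rewrite sumrN telescope_sumr// opprB.
have -> : W 0%N = (n ^ K)%:R * V s0.
  rewrite /W (eq_bigr (fun=> V s0)); last by move=> phi _; rewrite run0.
  by rewrite sumr_const card_ffun !card_ord mulr_natl.
by rewrite gerBl sumr_ge0.
Qed.

End averaging.

(** * Expectations under uniform sampling *)

Section discrete_expectation.
Context {disp : measure_display} {T : measurableType disp} {R : realType}.
Variable P : probability T R.

Lemma measurable_preimage_countable (S : countType) (Y : T -> S) (B : set S) :
  (forall s, measurable (Y @^-1` [set s])) -> measurable (Y @^-1` B).
Proof.
move=> mY.
rewrite (_ : _ @^-1` _ = \bigcup_(k : nat)
    (if choice.unpickle k is Some s then
       if pselect (B s) then Y @^-1` [set s] else classical_sets.set0
     else classical_sets.set0)).
  apply: bigcupT_measurable => k; case: (choice.unpickle k) => [s|]; last exact: measurable0.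
  by case: pselect => h; [exact: mY|exact: measurable0].
apply/seteqP; split => [w Bw|w [k _]].
  by exists (choice.pickle (Y w)) => //; rewrite choice.pickleK; case: pselect.
by case: (choice.unpickle k) => // s; case: pselect => //= Bs ->.
Qed.

Lemma integral_finite_valued (S : finType) (Y : T -> S) (G : S -> R) :
  (forall s, measurable (Y @^-1` [set s])) ->
  (\int[P]_w (G (Y w))%:E = \sum_s (G s)%:E * P (Y @^-1` [set s]))%E.
Proof.
move=> mY.
rewrite (eq_integral (fun w => \sum_s (G s)%:E * (\1_(Y @^-1` [set s]) w)%:E))%E; last first.
  move=> w _; rewrite (bigD1 (Y w))//= big1 ?adde0 => [|s sY].
    by rewrite indicE mem_set//= mule1.
  by rewrite indicE memNset ?mule0//= => Ys; rewrite Ys eqxx in sY.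
rewrite integral_sum//; last by move=> s; apply: integrableZl => //; exact: integrable_indic.
apply: eq_bigr => s _; rewrite integralZl//; last exact: integrable_indic.
by rewrite integral_indic// setIT.
Qed.

(** A sample point provides a drawn row, whence [n > 0] and a positive maximal row norm. *)
Lemma probability_inhabited : inhabited T.
Proof.
apply: contrapT => noT; have := probability_setT P.
rewrite (_ : setT = classical_sets.set0); last by apply/seteqP; split => // w; case: noT.
by rewrite measure0 => /eqP; rewrite eq_sym onee_eq0.
Qed.

End discrete_expectation.

Lemma sum_option (R : realType) (I : finType) (F : option I -> \bar R) :
  (\sum_s F s = F None + \sum_i F (Some i))%E.
Proof.
rewrite (bigD1 None)//=; congr (_ + _)%E.
rewrite (reindex_omap Some id) => [|[]]//=.
by apply: eq_bigl => s; rewrite eqxx.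
Qed.

Section sampling.
Context {disp : measure_display} {T : measurableType disp} {R : realType}.
Variables (P : probability T R) (n K : nat).
Variables (i : nat -> T -> 'I_n) (khat : T -> nat) (a0 : 'I_n).
Hypotheses (K1 : (1 <= K)%N) (unif : uniform_sampling P i K khat).

Let n0 : (0 < n)%N. Proof. exact: leq_ltn_trans (leq0n _) (ltn_ord a0). Qed.

Lemma sampling_measurable_row k B : measurable (i k @^-1` B).
Proof. by have [[mi _] _ _ _] := unif; apply: mi; exists B. Qed.

Lemma sampling_measurable_khat B : measurable (khat @^-1` B).
Proof. by have [[_ mk] _ _ _] := unif; apply: mk; exists B. Qed.

(** All the relevant randomness in one finite-valued variable: [l : 'I_K] encodes the output index
    [l.+1], and [None] collects the samples where [khat] leaves the range from 1 to [K]. *)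
Let Y w : option ('I_K * {ffun 'I_K -> 'I_n}) :=
  omap (fun l => (l, [ffun k : 'I_K => i k w])) [pick l : 'I_K | l.+1 == khat w].

(** The event takes the form of a finite intersection indexed as in [mutually_independent], so that
    its probability factors. *)
Let YE l phi : Y @^-1` [set Some (l, phi)] =
  \bigcap_(o in [set` None :: [seq Some k | k <- iota 0 K]])
    (if o is Some k then i k @^-1` [set extend a0 phi k] else khat @^-1` [set l.+1]).
Proof.
apply/seteqP; split => w.
  rewrite /Y /=; case: pickP => //= m /eqP mw [<- <-] [k|] /=; last by [].
  rewrite inE /= => /mapP[k']; rewrite mem_iota /= add0n => kK [->].
  by rewrite -[k']/(nat_of_ord (Ordinal kK)) extend_ord ffunE.
move=> h; rewrite /Y /=.
have hl := h None (mem_head _ _); rewrite /= in hl.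
case: pickP => [m /eqP|/(_ l)]; last by rewrite hl eqxx.
rewrite hl => -[] /val_inj -> /=; congr (Some (_, _)).
apply/ffunP => k; rewrite ffunE.
have := h (Some (k : nat)); rewrite /= extend_ord; apply.
by rewrite inE /= map_f// mem_iota /= add0n.
Qed.

Let mY s : measurable (Y @^-1` [set s]).
Proof.
have mS l phi : measurable (Y @^-1` [set Some (l, phi)]).
  rewrite YE; apply: fin_bigcap_measurable => [|[k|] _]; first exact: finite_seq.
    exact: sampling_measurable_row.
  exact: sampling_measurable_khat.
case: s => [[l phi]|]; first exact: mS.
rewrite (_ : _ @^-1` _ =
    ~` \bigcup_(p in [set: 'I_K * {ffun 'I_K -> 'I_n}]) Y @^-1` [set Some p]).
  apply: measurableC; apply: fin_bigcup_measurable => [|[l phi] _]; last exact: mS.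
  exact: finite_finset.
apply/seteqP; split => w /=; first by move=> Yw [p _ /=]; rewrite Yw.
by case Yw : (Y w) => [p|] //; case; exists p.
Qed.

Let PY l phi : P (Y @^-1` [set Some (l, phi)]) = (K%:R^-1 * (n ^ K)%:R^-1)%:E.
Proof.
have [_ Pi Pk ind] := unif.
rewrite YE ind; last 2 first.
- rewrite /= map_inj_uniq ?iota_uniq ?andbT; last by move=> ? ? [].
  by apply/negP => /mapP[].
- move=> [k|] _; first by exists [set extend a0 phi k].
  by exists [set l.+1].
rewrite big_cons Pk ?ltn_ord// big_map EFinM; congr (_ * _)%E.
rewrite (eq_bigr (fun=> (n%:R^-1)%:E)) => [|k _]; last exact: Pi.
by rewrite prodEFin big_const_seq count_predT size_iota iter_mulr_1 exprVn natrX.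
Qed.

(** The [K * n ^ K] other values of [Y], each of probability [K^-1 * (n ^ K)^-1], already exhaust
    the total mass 1. *)
Let PYN : P (Y @^-1` [set None]) = 0%E.
Proof.
have := integral_finite_valued P (fun=> 1) mY.
rewrite integral_cst// mul1e [X in X = _]probability_setT.
rewrite sum_option mul1e (eq_bigr (fun=> (K%:R^-1 * (n ^ K)%:R^-1)%:E)); last first.
  by move=> [l phi] _; rewrite mul1e PY.
rewrite sumEFin sumr_const card_prod card_ffun !card_ord.
rewrite -[X in _ = (_ + X%:E)%E -> _]mulr_natr natrM mulrACA.
rewrite !mulVf ?pnatr_eq0 -?lt0n ?expn_gt0 ?n0// mul1r.
have : P (Y @^-1` [set None]) \is a fin_num by exact: fin_num_measure.
by case: (P _) => // r _; rewrite -EFinD => -[] r1; congr _%:E; lra.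
Qed.

(** Off the null event [Y = None] the integrand is a function of [Y], because the iterate of index
    [khat.-1] reads only draws among the first [K]; the integral is then a uniform finite
    average. *)
Lemma expectation_sampled (S : Type) (step : 'I_n -> S -> S) (s0 : S)
    (run : (nat -> 'I_n) -> nat -> S) (F : S -> R) :
  (forall j, run j 0%N = s0) ->
  (forall j k, run j k.+1 = step (j k) (run j k)) ->
  (\int[P]_w (F (run (i^~ w) (khat w).-1))%:E =
   (K%:R^-1 * (n ^ K)%:R^-1 *
    \sum_(k < K) \sum_(phi : {ffun 'I_K -> 'I_n}) F (run (extend a0 phi) k))%:E)%E.
Proof.
move=> run0 runS.
pose G (s : option ('I_K * {ffun 'I_K -> 'I_n})) : R :=
  if s is Some (l, phi) then F (run (extend a0 phi) l) else 0.
(* On the null event [khat] may be arbitrarily large and [Y] forgets it. Measurability therefore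
   goes through the countably valued pair of [khat] and the list of the first [khat] draws. *)
have mF : measurable_fun setT (fun w => (F (run (i^~ w) (khat w).-1))%:E).
  pose H (s : nat * seq 'I_n) := F (run (nth a0 s.2) s.1.-1).
  pose X w := (khat w, [seq i k w | k <- iota 0 (khat w)]).
  have FH w : F (run (i^~ w) (khat w).-1) = H (X w).
    rewrite /H; congr (F _); apply: (eq_run run0 runS) => l lk.
    have lk' : (l < khat w)%N := leq_trans lk (leq_pred _).
    by rewrite (nth_map 0%N) ?size_iota// nth_iota.
  under eq_fun do rewrite FH.
  move=> _ B _; rewrite setTI.
  apply: (@measurable_preimage_countable _ _ _ X [set s | B (H s)%:E]) => -[l s].
  rewrite (_ : _ @^-1` _ = khat @^-1` [set m | m = l /\ size s = l] `&`
      \bigcap_(k in [set k | (k < l)%N]) i k @^-1` [set nth a0 s k]); last first.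
    apply/seteqP; split => w; rewrite /X /=.
      move=> [<- <-]; split; first by rewrite size_map size_iota.
      by move=> k /= kl; rewrite (nth_map 0%N) ?size_iota// nth_iota.
    move=> [[-> sl] h]; congr pair; apply: (@eq_from_nth _ a0).
      by rewrite size_map size_iota.
    rewrite size_map size_iota => k kl.
    by rewrite (nth_map 0%N) ?size_iota// nth_iota//; exact: h.
  apply: measurableI; first exact: sampling_measurable_khat.
  by apply: bigcap_measurableType => k _; exact: sampling_measurable_row.
rewrite (@ae_eq_integral _ _ _ P setT (fun w => (G (Y w))%:E)) => //.
- rewrite integral_finite_valued// sum_option mul0e add0e.
  rewrite pair_big/= mulr_sumr -sumEFin; apply: eq_bigr => -[l phi] _.
  by rewrite PY -EFinM /= mulrC.
- move=> _ B _; rewrite setTI.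
  by apply: (@measurable_preimage_countable _ _ _ Y [set s | B (G s)%:E]) => s; exact: mY.
exists (Y @^-1` [set None]); split => // w /=; apply: contra_notP.
rewrite /Y; case: pickP => //= l /eqP lw _ _; rewrite -lw /=; congr (F _)%:E.
apply: (eq_run run0 runS) => k kl.
by rewrite -[k]/(nat_of_ord (Ordinal (ltn_trans kl (ltn_ord l)))) extend_ord ffunE.
Qed.

End sampling.

(** * The expected gap and the expected cost *)

Lemma continuous_sumr (R : realType) (V : topologicalType) (I : Type)
    (s : seq I) (f : I -> V -> R) :
  (forall i, continuous (f i)) -> continuous (fun v => \sum_(i <- s) f i v).
Proof.
move=> cf; elim: s => [|i s IH] v.
  by rewrite (_ : (fun _ => _) = cst 0); [exact: cvg_cst|apply/funext => u; rewrite big_nil].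
rewrite (_ : (fun _ => _) = f i \+ (fun v => \sum_(j <- s) f j v)); last first.
  by apply/funext => u; rewrite big_cons.
by apply: continuousD; [exact: cf|exact: IH].
Qed.

Lemma continuous_coord_comp (R : realType) (V : topologicalType) m
    (q : V -> 'cV[R]_m) i : continuous q -> continuous (fun v => q v i 0).
Proof.
move=> cq v; apply: (@continuous_comp _ _ _ q (fun u : 'cV[R]_m => u i 0)).
  exact: cq.
exact: coord_continuous.
Qed.

Lemma continuous_fst (U V : topologicalType) : continuous (@fst U V).
Proof. by move=> z; exact: cvg_fst. Qed.

Lemma continuous_snd (U V : topologicalType) : continuous (@snd U V).
Proof. by move=> z; exact: cvg_snd. Qed.

Lemma enorm_sqr (R : realType) m (u : 'cV[R]_m) : enorm u ^+ 2 = \sum_i u i 0 ^+ 2.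
Proof.
rewrite sqr_sqrtr; last by apply: sumr_ge0 => j _; rewrite -expr2 sqr_ge0.
by apply: eq_bigr => j _; rewrite expr2.
Qed.

(** Compactness bounds the continuous squared distance on [Z], which makes [sup] a true upper bound
    and not a default value. *)
Lemma DZ_upper_bound (R : realType) n d (x0 : 'cV[R]_d) (y0 : 'cV[R]_n)
    (Z : set ('cV[R]_d * 'cV[R]_n)) z : compact Z -> Z z ->
  enorm (z.1 - x0) ^+ 2 + enorm (z.2 - y0) ^+ 2 <= DZ x0 y0 Z.
Proof.
move=> cZ Zz.
pose q (z : 'cV[R]_d * 'cV[R]_n) := enorm (z.1 - x0) ^+ 2 + enorm (z.2 - y0) ^+ 2.
have cq : continuous q.
  have sqc m (w : 'cV[R]_m) (p : 'cV[R]_d * 'cV[R]_n -> 'cV[R]_m) :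
      continuous p -> continuous (fun z => enorm (p z - w) ^+ 2).
    move=> cp.
    rewrite (_ : (fun _ => _) = fun z => \sum_i (p z i 0 - w i 0) ^+ 2); last first.
      by apply/funext => v; rewrite enorm_sqr; apply: eq_bigr => i _; rewrite !mxE.
    apply: continuous_sumr => i v.
    apply: (@continuous_comp _ _ _ (fun z => p z i 0 - w i 0) (fun v => v ^+ 2)).
      by apply: cvgB; [exact: continuous_coord_comp|exact: cvg_cst].
    exact: exprn_continuous.
  move=> v; apply: cvgD.
    exact: (sqc _ _ fst (@continuous_fst _ _)).
  exact: (sqc _ _ snd (@continuous_snd _ _)).
have [c cZc cmax] := compact_EVT_max (ex_intro _ z Zz) cZ (continuous_subspaceT cq).
apply: ub_le_sup; last by exists z.
exists (q c) => _ [v Zv <-]; apply: cmax; exact: mem_set.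
Qed.

Lemma nnz_sum (R : realType) n d (A : 'M[R]_(n, d)) : (nnz A = \sum_a #|row_supp A a|)%N.
Proof.
rewrite /nnz -sum1_card.
under eq_bigl do rewrite inE.
rewrite -(pair_big_dep xpredT (fun a j => A a j != 0) (fun _ _ => 1%N))/=.
apply: eq_bigr => a _; rewrite sum1_card; apply: eq_card => j.
by rewrite [RHS]inE.
Qed.

Section cost.
Context {disp : measure_display} {T : measurableType disp} {R : realType}.
Variables (P : probability T R) (n d : nat) (A : 'M[R]_(n, d)) (K : nat).
Variables (i : nat -> T -> 'I_n) (khat : T -> nat).
Hypothesis unif : uniform_sampling P i K khat.

(** The nonzero entries are counted row by row, and each row has probability [1 / n]. *)
Lemma expected_row_supp (c : R) k :
  (\int[P]_w (c * #|row_supp A (i k w)|%:R)%:E =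
   (c * ((nnz A)%:R / n%:R))%:E)%E.
Proof.
have [_ Pi _ _] := unif.
rewrite (integral_finite_valued P (fun a => c * #|row_supp A a|%:R)); last first.
  by move=> a; exact: (sampling_measurable_row unif).
under eq_bigr do rewrite Pi -EFinM.
by rewrite sumEFin nnz_sum natr_sum mulr_suml mulr_sumr; under eq_bigr do rewrite -mulrA.
Qed.

Lemma expected_cost (c : R) (once : T -> R) (iter : nat -> T -> R) : 0 <= c ->
  operation_counts A i c once iter ->
  ('E_P[fun w => (once w + \sum_(k < K) iter k w)%R] <=
   (c * (nnz A)%:R + K%:R * (c * ((nnz A)%:R / n%:R)))%:E)%E.
Proof.
move=> c0 [mo mi bo bi]; rewrite unlock.
under eq_integral do rewrite EFinD -sumEFin.
have m1 : measurable_fun setT (EFin \o once) by apply/measurable_EFinP.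
have m2 k : measurable_fun setT (EFin \o iter k) by apply/measurable_EFinP.
rewrite ge0_integralD//; last 3 first.
- by move=> w _; rewrite lee_fin; have /andP[] := bo w.
- by move=> w _; apply: sume_ge0 => k _; rewrite lee_fin; have /andP[] := bi k w.
- by apply: emeasurable_sum => k; exact: m2.
rewrite ge0_integral_sum//; last 2 first.
- by move=> k; exact: m2.
- by move=> k w _; rewrite lee_fin; have /andP[] := bi k w.
rewrite EFinD; apply: leeD.
  apply: (@le_trans _ _ (\int[P]_w (c * (nnz A)%:R)%:E)%E).
    apply: ge0_le_integral => // [w _|w _].
    - by rewrite lee_fin; have /andP[] := bo w.
    - by rewrite lee_fin; have /andP[] := bo w.
  by rewrite integral_cst// [X in (_ * X)%E]probability_setT mule1.
apply: (@le_trans _ _ (\sum_(k < K) (c * ((nnz A)%:R / n%:R))%:E)%E); last first.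
  by rewrite sumEFin sumr_const card_ord [X in (_ <= X%:E)%E]mulr_natl.
apply: lee_sum => k _; rewrite -(expected_row_supp c k).
apply: ge0_le_integral => // [w _| | |w _].
- by rewrite lee_fin; have /andP[] := bi k w.
- exact: m2.
- move=> _ B _; rewrite setTI.
  exact: (sampling_measurable_row unif k [set a | B (c * #|row_supp A a|%:R)%:E]).
- by rewrite lee_fin; have /andP[] := bi k w.
Qed.

End cost.

Section max_expected_gap.
Variables (R : realType) (n d : nat) (A : 'M[R]_(n, d)).
Variables (g : 'cV[R]_d -> \bar R) (gs : 'I_d -> R -> \bar R).
Variables (h : 'cV[R]_n -> \bar R) (hs : 'I_n -> R -> \bar R).
Hypotheses (pg : proper_convex_lsc g) (ph : proper_convex_lsc h).
Hypotheses (sg : separable_sum g gs) (sh : separable_sum h hs).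
Hypotheses (rowA : forall i, row i A != 0) (colA : forall j, col j A != 0).
Variables (tau : 'I_d -> R) (sigma : 'I_n -> R) (theta : 'I_d -> R).
Hypothesis tauE : forall j, tau j = (#|col_supp A j|%:R * max_row_norm A)^-1.
Hypothesis sigmaE : forall i, sigma i = (row_norm A i)^-1.
Hypothesis thetaE : forall j, theta j = #|col_supp A j|%:R.
Variables (x0 : 'cV[R]_d) (y0 : 'cV[R]_n).
Context {disp : measure_display} {T : measurableType disp}.
Variables (P : probability T R) (i : nat -> T -> 'I_n) (K : nat) (khat : T -> nat).
Hypotheses (K1 : (1 <= K)%N) (unif : uniform_sampling P i K khat).

Let M := max_row_norm A.
Let run := pure_cd A gs hs (fun=> tau) (fun=> sigma) (fun=> theta) x0 y0.
Let E := expected_gap P A g gs h hs (fun=> tau) (fun=> sigma) (fun=> theta) x0 y0 i khat.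

Let r0 j : 0 < row_norm A j. Proof. exact: row_norm_gt0. Qed.

Lemma col_supp_gt0 j : (0 < #|col_supp A j|)%N.
Proof.
rewrite card_gt0; apply: contra (colA j) => /eqP A0; apply/eqP/colP => a.
by rewrite !mxE; apply/eqP; move/setP: A0 => /(_ a); rewrite !inE => /negbFE.
Qed.

Lemma expected_gapE z : E z =
  (\int[P]_w gap A g h (bar_pair A gs h tau sigma (run (i^~ w) (khat w).-1)).1
                       (bar_pair A gs h tau sigma (run (i^~ w) (khat w).-1)).2 z.1 z.2)%E.
Proof.
rewrite /E /expected_gap; apply: eq_integral => w _.
by rewrite /pure_cd_bar -/run; case: (run _ _).
Qed.

Let a0 : exists a : 'I_n, True.
Proof. by have [w] := probability_inhabited P; exists (i 0%N w). Qed.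

Let M0 : 0 < M.
Proof. by have [a _] := a0; exact: lt_le_trans (r0 a) (row_norm_le_max A a). Qed.

Let n0 : (0 < n)%N.
Proof. by have [a _] := a0; exact: leq_ltn_trans (leq0n a) (ltn_ord a). Qed.

Lemma expected_gap_fin a z : (g z.1 < +oo)%E -> (h z.2 < +oo)%E ->
  E z = (K%:R^-1 * (n ^ K)%:R^-1 * \sum_(k < K) \sum_(phi : {ffun 'I_K -> 'I_n})
     gap_real A g h (bar_pair A gs h tau sigma (run (extend a phi) k)) z.1 z.2)%:E.
Proof.
move=> gz hz; rewrite expected_gapE.
under eq_integral do rewrite (gap_fin pg ph sg sh M0 r0 col_supp_gt0 tauE sigmaE)//.
exact: (@expectation_sampled _ _ _ _ _ _ _ _ a K1 unif _
  (pure_cd_step A gs hs tau sigma theta) (x0, y0) run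
  (fun p => gap_real A g h (bar_pair A gs h tau sigma p) z.1 z.2)).
Qed.

Lemma expected_gap_Ny z : (g z.1 + h z.2 = +oo)%E -> E z = -oo%E.
Proof.
move=> ghz; rewrite expected_gapE.
under eq_integral do rewrite (gap_Ny pg ph sg sh M0 r0 col_supp_gt0 tauE sigmaE)//.
by rewrite (integral_cst P measurableT -oo%E) [X in (_ * X)%E]probability_setT mule1.
Qed.

Let dom_cases z : ((g z.1 < +oo)%E /\ (h z.2 < +oo)%E) \/ (g z.1 + h z.2 = +oo)%E.
Proof.
have [[gN _] _ _] := pg; have [[hN _] _ _] := ph.
by move: (gN z.1) (hN z.2); case: (g _) => [?||]//; case: (h _) => [?||]// _ _;
  [left; rewrite !ltry|right|right|right].
Qed.

(** On the domains [descent_sum] gives [n * V / (2 * K)]; then [V <= M * D] since every row norm is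
    at most [M], and the factor 1/2 is given away. Elsewhere the expected gap is [-oo]. *)
Lemma expected_gap_le z : (E z <= (n%:R * M / K%:R *
  (enorm (z.1 - x0) ^+ 2 + enorm (z.2 - y0) ^+ 2))%:E)%E.
Proof.
have [a _] := a0.
have [[gz hz]|ghz] := dom_cases z; last by rewrite expected_gap_Ny// leNye.
rewrite (expected_gap_fin a gz hz) lee_fin.
have := @descent_sum R n K a _ (pure_cd_step A gs hs tau sigma theta) (x0, y0) run
  (fun=> erefl) (fun _ _ => erefl)
  (fun p => gap_real A g h (bar_pair A gs h tau sigma p) z.1 z.2)
  (lyapunov A z.1 z.2) (lyapunov_ge0 _ _ _)
  (fun p => one_step pg ph sg sh M0 r0 col_supp_gt0 tauE sigmaE thetaE p gz hz).
set S := \sum_(k < K) _; set V := lyapunov _ _ _ _; set D := _ + _.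
have VD : V <= M * D.
  rewrite /V /D /lyapunov mulrDr !enorm_sqr; apply: lerD.
    rewrite le_eqVlt; apply/orP; left; apply/eqP; congr (_ * _).
    by apply: eq_bigr => j _; rewrite !mxE -sqrrN opprB.
  rewrite mulr_sumr; apply: ler_sum => j _; rewrite !mxE -[in leRHS]sqrrN opprB.
  by rewrite ler_wpM2r ?sqr_ge0// row_norm_le_max.
have V0 : 0 <= V by exact: lyapunov_ge0.
have nK0 : 0 < (n ^ K)%:R :> R by rewrite ltr0n expn_gt0 n0.
have K0 : 0 < K%:R :> R by rewrite ltr0n.
rewrite expnS natrM => SV.
have n0' : 0 <= n%:R :> R by [].
rewrite -mulrA ler_pdivrMl// ler_pdivrMl//.
have -> : (n ^ K)%:R * (K%:R * (n%:R * M / K%:R * D)) = n%:R * (n ^ K)%:R * (M * D).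
  by field; rewrite gt_eqF.
have c0 : 0 <= n%:R * (n ^ K)%:R :> R by [].
have : n%:R * (n ^ K)%:R * V <= n%:R * (n ^ K)%:R * (M * D) by rewrite ler_wpM2l.
have : 0 <= n%:R * (n ^ K)%:R * V by rewrite mulr_ge0.
lra.
Qed.

Lemma expected_gap_max (Z : set ('cV[R]_d * 'cV[R]_n)) : compact Z -> Z !=set0 ->
  exists2 m, is_max_on Z E m &
    (m <= (n%:R * M / K%:R * DZ x0 y0 Z)%:E)%E.
Proof.
move=> cZ Z0.
have [a _] := a0.
have [[gN _] _ lg] := pg; have [[hN _] _ lh] := ph.
pose w : R := K%:R^-1 * (n ^ K)%:R^-1.
pose b k (phi : {ffun 'I_K -> 'I_n}) := bar_pair A gs h tau sigma (run (extend a phi) k).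
(* [q] is the negated average of the part of the gap that is affine in [z], hence continuous. *)
pose q (z : 'cV[R]_d * 'cV[R]_n) := w * (\sum_(k < K) \sum_(phi : {ffun 'I_K -> 'I_n})
  - (fine (g (b k phi).1) + fine (h (b k phi).2) + dotp (A *m (b k phi).1) z.2
    - dotp (A *m z.1) (b k phi).2)).
have cdot m (u : 'cV[R]_m) (p : 'cV[R]_d * 'cV[R]_n -> 'cV[R]_m) :
    (forall j, continuous (fun z => p z j 0)) -> continuous (fun z => dotp u (p z)).
  by move=> cp; apply: continuous_sumr => j v; apply: cvgMr; exact: cp.
have c1 j : continuous (fun z : 'cV[R]_d * 'cV[R]_n => z.1 j 0).
  by apply: (@continuous_coord_comp _ _ _ fst); exact: continuous_fst.
have c2 j : continuous (fun z : 'cV[R]_d * 'cV[R]_n => z.2 j 0).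
  by apply: (@continuous_coord_comp _ _ _ snd); exact: continuous_snd.
have cA j : continuous (fun z : 'cV[R]_d * 'cV[R]_n => (A *m z.1) j 0).
  rewrite (_ : (fun _ => _) =
      fun z : 'cV[R]_d * 'cV[R]_n => \sum_l A j l * z.1 l 0); last first.
    by apply/funext => z; rewrite mxE.
  apply: continuous_sumr => l v; apply: cvgMr.
  exact: c1.
have cAr v : continuous (fun z : 'cV[R]_d * 'cV[R]_n => dotp (A *m z.1) v).
  rewrite (_ : (fun _ => _) = fun z : 'cV[R]_d * 'cV[R]_n => dotp v (A *m z.1)).
    exact: cdot.
  by apply/funext => z; apply: eq_bigr => j _; rewrite mulrC.
have cq : continuous q.
  move=> z; apply: cvgMr; apply: (continuous_sumr _) => k {}z.
  apply: (continuous_sumr _) => phi {}z; apply: cvgN; apply: cvgB.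
    apply: cvgD; first exact: cvg_cst.
    by apply: cdot; exact: c2.
  exact: cAr.
(* This holds on the whole space: off the domains both sides are [-oo]. On them, the [K * n ^ K]
   copies of [g z.1 + h z.2], weighted by [w], add up to a single one. *)
have EqE z : E z = (- ((q z)%:E + (g z.1 + h z.2)))%E.
  have [[gz hz]|ghz] := dom_cases z; last by rewrite expected_gap_Ny// ghz.
  rewrite (expected_gap_fin a gz hz).
  have fineg : g z.1 = (fine (g z.1))%:E by rewrite fineK// fin_numE gN lt_eqF.
  have fineh : h z.2 = (fine (h z.2))%:E by rewrite fineK// fin_numE hN lt_eqF.
  rewrite fineg fineh -!EFinD -EFinN; congr _%:E.
  rewrite /gap_real /q -/w; set D := fine (g z.1) + fine (h z.2).
  have sumD : \sum_(k < K) \sum_(phi : {ffun 'I_K -> 'I_n}) D = K%:R * ((n ^ K)%:R * D).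
    by rewrite !sumr_const card_ffun !card_ord !mulr_natl.
  have wD : w * (K%:R * ((n ^ K)%:R * D)) = D.
    by rewrite /w; field; rewrite !pnatr_eq0 -!lt0n expn_gt0 n0 K1.
  under eq_bigr do rewrite sumrB.
  under [in RHS]eq_bigr do rewrite sumrN.
  by rewrite sumrB sumrN sumD mulrBr wD mulrN [RHS]opprD opprK.
have lsc : lower_semicontinuous (fun z : 'cV[R]_d * 'cV[R]_n => (q z)%:E + (g z.1 + h z.2))%E.
  apply: lsc_add => //.
  - by move=> z; move: (gN z.1) (hN z.2); case: (g _); case: (h _).
  - exact: continuous_lsc.
  apply: lsc_add => //.
    exact: (lsc_comp (@continuous_fst _ _) lg).
  exact: (lsc_comp (@continuous_snd _ _) lh).
have [|z Zz zmin] := lsc_compact_min _ lsc cZ Z0.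
  by move=> z; move: (gN z.1) (hN z.2); case: (g _); case: (h _).
exists (E z).
  split; first by exists z.
  by move=> u Zu; rewrite !EqE leeN2; exact: zmin.
apply: le_trans (expected_gap_le z) _; rewrite lee_fin ler_wpM2l//.
  by rewrite divr_ge0// mulr_ge0// ltW.
exact: DZ_upper_bound.
Qed.

End max_expected_gap.

(** * Choice of the number of iterations and the resulting complexity *)

Theorem theorem3p13 (R : realType) (c : R) (hc : 0 < c) :
  exists2 C : R, 0 < C &
  forall (n d : nat) (A : 'M[R]_(n, d))
    (g : 'cV[R]_d -> \bar R) (gs : 'I_d -> R -> \bar R)
    (hconj : 'cV[R]_n -> \bar R) (hs : 'I_n -> R -> \bar R)
    (x0 : 'cV[R]_d) (y0 : 'cV[R]_n)
    (pi_ : 'I_d -> R)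
    (tau : nat -> 'I_d -> R) (sigma : nat -> 'I_n -> R)
    (theta : nat -> 'I_d -> R)
    (Z : set ('cV[R]_d * 'cV[R]_n)),
    proper_convex_lsc g -> proper_convex_lsc hconj ->
    separable_sum g gs -> separable_sum hconj hs ->
    (exists xs ys, saddle_point A g hconj xs ys) ->
    (forall i, row i A != 0) -> (forall j, col j A != 0) ->
    (g x0 < +oo)%E -> (hconj y0 < +oo)%E ->
    (forall j, pi_ j = #|col_supp A j|%:R / n%:R) ->
    (forall k j, tau k j = 1 / (pi_ j * n%:R * max_row_norm A)) ->
    (forall k i, sigma k i = 1 / row_norm A i) ->
    (forall k j, theta k j = n%:R * pi_ j) ->
    Z !=set0 -> compact Z ->
    (forall (disp : measure_display) (T : measurableType disp)
        (P : probability T R) (i : nat -> T -> 'I_n)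
        (K : nat) (khat : T -> nat),
        (1 <= K)%N -> uniform_sampling P i K khat ->
        exists2 m : \bar R,
          is_max_on Z
            (expected_gap P A g gs hconj hs tau sigma theta x0 y0 i khat) m &
          (m <= (n%:R * max_row_norm A / K%:R * DZ x0 y0 Z)%:E)%E)
    /\
    (forall eps : R, 0 < eps ->
      exists2 K : nat, (1 <= K)%N &
      forall (disp : measure_display) (T : measurableType disp)
        (P : probability T R) (i : nat -> T -> 'I_n) (khat : T -> nat),
        uniform_sampling P i K khat ->
        (exists2 m : \bar R,
          is_max_on Z
            (expected_gap P A g gs hconj hs tau sigma theta x0 y0 i khat) m &
          (m <= eps%:E)%E)
        /\
        (forall (once : T -> R) (iter : nat -> T -> R),
          operation_counts A i c once iter ->
          ('E_P[fun w => (once w + \sum_(k < K) iter k w)%R] <=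
             (C * ((nnz A)%:R
                   + (nnz A)%:R * max_row_norm A * DZ x0 y0 Z * eps^-1))%:E)%E)).
Proof.
(* One [c] pays for the one-time cost; the other pays for the extra iteration due to rounding [K]
   up, and for the main term with room to spare. *)
exists (2 * c); first by rewrite mulr_gt0.
move=> n d A g gs hconj hs x0 y0 pi_ tau sigma theta Z pg ph sg sh _ rowA colA _ _
  piE tauE sigmaE thetaE Z0 cZ.
have tau_const : tau = fun=> tau 0%N by apply/funext => k; apply/funext => j; rewrite !tauE.
have sigma_const : sigma = fun=> sigma 0%N.
  by apply/funext => k; apply/funext => j; rewrite !sigmaE.
have theta_const : theta = fun=> theta 0%N.
  by apply/funext => k; apply/funext => j; rewrite !thetaE.
have sample_gap (disp : measure_display) (T : measurableType disp)
    (P : probability T R) (i : nat -> T -> 'I_n) (K : nat) (khat : T -> nat) :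
    (1 <= K)%N -> uniform_sampling P i K khat ->
    exists2 m : \bar R,
      is_max_on Z
        (expected_gap P A g gs hconj hs tau sigma theta x0 y0 i khat) m &
      (m <= (n%:R * max_row_norm A / K%:R * DZ x0 y0 Z)%:E)%E.
  move=> K1 unif; rewrite tau_const sigma_const theta_const.
  have [w] := probability_inhabited P.
  have n0 : n%:R != 0 :> R.
    by rewrite pnatr_eq0 -lt0n; exact: leq_ltn_trans (leq0n _) (ltn_ord (i 0%N w)).
  have piN j : pi_ j * n%:R = #|col_supp A j|%:R by rewrite piE divfK.
  apply: (expected_gap_max pg ph sg sh rowA colA) => // j.
  - by rewrite tauE piN div1r.
  - by rewrite sigmaE div1r.
  - by rewrite thetaE mulrC piN.
split; first exact: sample_gap.
move=> eps eps0.
have D0 : 0 <= DZ x0 y0 Z.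
  have [z Zz] := Z0; apply: le_trans (DZ_upper_bound x0 y0 cZ Zz).
  by rewrite addr_ge0 ?sqr_ge0.
have M0 : 0 <= max_row_norm A by rewrite /max_row_norm bigmax_ge_id.
(* [X] is the real number of iterations at which the gap bound equals [eps]. Taking [K] as its
   truncation plus one gives [X < K <= X + 1], and [1 <= K] even when [X = 0]. *)
set X := n%:R * max_row_norm A * DZ x0 y0 Z / eps.
have X0 : 0 <= X by rewrite divr_ge0 ?(ltW eps0)// !mulr_ge0.
have /andP[trX Xtr] := truncn_itv X0.
exists (Num.truncn X).+1 => // disp T P i khat unif; split.
  have [m mZ mle] := sample_gap _ _ _ _ _ _ (ltn0Sn _) unif.
  exists m => //; apply: le_trans mle _; rewrite lee_fin.
  rewrite mulrAC ler_pdivrMr ?ltr0n// [leRHS]mulrC -ler_pdivrMr//.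
  exact: ltW.
move=> once iter ops.
apply: le_trans (expected_cost unif (ltW hc) ops) _; rewrite lee_fin.
have [w] := probability_inhabited P.
have n1 : 1 <= n%:R :> R.
  by rewrite ler1n; exact: leq_ltn_trans (leq0n _) (ltn_ord (i 0%N w)).
set N := (nnz A)%:R; have N0 : 0 <= N by rewrite ler0n.
have : (Num.truncn X).+1%:R * (c * (N / n%:R)) <= (X + 1) * (c * (N / n%:R)).
  by rewrite ler_wpM2r ?mulr_ge0 ?divr_ge0 ?(ltW hc)// -natr1 lerD2r.
move=> /(lerD (lexx (c * N))) /le_trans; apply.
rewrite mulrDl mul1r.
(* The factor [n] of [X] cancels against the average iteration cost [nnz A / n], so the bound is
   free of [n]. *)
have -> : X * (c * (N / n%:R)) = c * (N * max_row_norm A * DZ x0 y0 Z * eps^-1).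
  by rewrite /X; field; rewrite !gt_eqF//; exact: lt_le_trans n1.
have : c * (N / n%:R) <= c * N.
  by rewrite ler_pM2l// ler_pdivrMr ?(lt_le_trans _ n1)// ler_peMr.
have : 0 <= c * (N * max_row_norm A * DZ x0 y0 Z * eps^-1).
  by rewrite !mulr_ge0 ?invr_ge0// ltW.
rewrite mulrDr -!(mulrA 2 c); lra.
Qed.
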